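(* Let $G$ be a connected Lie group endowed with a left-invariant Riemannian metric, let $V: G \to \mathbb{R}$ be a smooth non-negative function, and suppose there exist $g_0 \in G$ and a smooth function $V_{\mathrm{ext}}: G \times G \to \mathbb{R}$ with $V_{\mathrm{ext}}(\cdot, g_0) = V$ and $V_{\mathrm{ext}}(hg, h\bar g) = V_{\mathrm{ext}}(g, \bar g)$ for all $g, \bar g, h \in G$. Let $g \in \Omega$. Then $g$ solves $$D_t^3 \dot g + R(D_t \dot g, \dot g)\dot g + \mathrm{grad}\, V(g(t)) = 0 \quad \text{on } [a,b]$$ if and only if $\xi := g^{-1}\dot g$ and $h := g_0^{-1} g$ solve \begin{align*} \dot\xi &= \eta + \mathrm{ad}^\dagger_\xi \xi, \\ 0 &= \ddot\eta + 2\nabla^{\mathfrak g}_\xi \dot\eta + \nabla^{\mathfrak g}_\eta \eta + \nabla^{\mathfrak g}_{\mathrm{ad}^\dagger_\xi \xi}\eta + \nabla^{\mathfrak g}_\xi \nabla^{\mathfrak g}_\xi \eta + R(\eta, \xi)\xi + (L_{h^{-1}})_* \,\mathrm{grad}_1 V_{\mathrm{ext}}(h, e), \\ \dot h &= (L_h)_* \xi . \end{align*}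
   Context: $G$ has identity $e$ and Lie algebra $\mathfrak g = T_eG$; $L_g(h) = gh$; for $X \in T_hG$, $gX := (L_g)_*X$, so $g^{-1}\dot g$ is a curve in $\mathfrak g$. $\langle\cdot,\cdot\rangle$ is the left-invariant metric, $\nabla$ its Levi-Civita connection, $D_t$ the covariant derivative along curves, $R(X,Y)Z = \nabla_X\nabla_Y Z - \nabla_Y\nabla_X Z - \nabla_{[X,Y]}Z$ the curvature endomorphism (evaluated at $e$ on elements of $\mathfrak g$). For $\xi\in\mathfrak g$, $\phi(\xi)$ is the left-invariant vector field $\phi(\xi)(g) = (L_g)_*\xi$. The Riemannian $\mathfrak g$-connection is $\nabla^{\mathfrak g}_\xi\eta := (\nabla_{\phi(\xi)}\phi(\eta))(e)$ for $\xi,\eta\in\mathfrak g$, applied pointwise in $t$ to curves in $\mathfrak g$. $\mathrm{ad}^\dagger_\xi\eta := (\mathrm{ad}^*_\xi \eta^\flat)^\sharp$, i.e. $\langle \mathrm{ad}^\dagger_\xi\eta, \zeta\rangle = \langle \eta, [\xi,\zeta]\rangle$ for all $\zeta\in\mathfrak g$. $\mathrm{grad}_1$ is the gradient with respect to the first argument, with respect to $\langle\cdot,\cdot\rangle$. Given $a<b$ and boundary data $(q_a,v_a),(q_b,v_b)\in TG$, $\Omega$ is the set of $C^1$, piecewise smooth curves $g:[a,b]\to G$ with $g(a)=q_a$, $g(b)=q_b$, $\dot g(a)=v_a$, $\dot g(b)=v_b$. Solutions of the displayed equation are understood to be $C^\infty$ curves on $[a,b]$. *)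

(* Defs.v *)
From HB Require Import structures.
From mathcomp Require Import all_boot all_order all_algebra.
From mathcomp Require Import all_classical all_reals all_analysis.
Import Order.TTheory GRing.Theory Num.Theory.
Import numFieldNormedType.Exports.

Set Implicit Arguments.
Unset Strict Implicit.
Unset Printing Implicit Defensive.

Local Open Scope classical_set_scope.
Local Open Scope ring_scope.

Section Calculus.
Context {R : realType}.

(* Only used for open U and finite-dimensional V. *)
Fixpoint Ck_on (V W : normedModType R) (U : set V) (k : nat) (f : V -> W)
    : Prop :=
  if k is k'.+1 then
    (forall x, U x -> differentiable f x) /\
    (forall v : V, Ck_on U k' (fun x => 'd f x v))
  else forall x, U x -> {for x, continuous f}.

Definition smooth_on (V W : normedModType R) (U : set V) (f : V -> W) :=
  forall k, Ck_on U k f.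

(* Derivative computed inside I: it is one-sided at an endpoint of I, and
   depends only on the values of f on I when t belongs to I. *)
Definition wquot (V : normedModType R) (f : R -> V) (t s : R) : V :=
  (s - t)^-1 *: (f s - f t).

Definition wderive (V : normedModType R) (I : set R) (f : R -> V) (t : R) : V :=
  lim (wquot f t s @[s --> within I t^']).

Definition wderivable (V : normedModType R) (I : set R) (f : R -> V) (t : R) :=
  cvg (wquot f t s @[s --> within I t^']).

Fixpoint Ck_within (V : normedModType R) (I : set R) (k : nat) (f : R -> V)
    : Prop :=
  if k is k'.+1 then
    (forall t, I t -> wderivable I f t) /\ Ck_within I k' (wderive I f)
  else {within I, continuous f}.

Definition smooth_within (V : normedModType R) (I : set R) (f : R -> V) :=
  forall k, Ck_within I k f.

End Calculus.

(* The inverse [cinv] is only meaningful on the image [cimg] of the chart. *)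
Record chart (R : realType) (n : nat) (M : topologicalType) := Chart {
  cdom : set M;
  cmap : M -> 'rV[R]_n;
  cinv : 'rV[R]_n -> M;
  cdom_open : open cdom;
  cimg_open : open (cmap @` cdom);
  cmapK : {in cdom, cancel cmap cinv};
  cmap_continuous : {within cdom, continuous cmap};
  cinv_continuous : {within cmap @` cdom, continuous cinv} }.

Definition cimg (R : realType) (n : nat) (M : topologicalType)
  (c : chart R n M) : set 'rV[R]_n := cmap c @` cdom c.

HB.mixin Record isManifold (R : realType) (n : nat) M of Topological M := {
  atlas : set (chart R n M);
  atlas_cover : forall p : M, exists2 c, atlas c & cdom c p;
  atlas_smooth : forall c d, atlas c -> atlas d ->
    smooth_on (cmap c @` (cdom c `&` cdom d)) (cmap d \o cinv c);
  manifold_hausdorff : hausdorff_space M;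
  manifold_second_countable : @second_countable M }.

#[short(type="manifoldType")]
HB.structure Definition Manifold (R : realType) (n : nat) :=
  {M of isManifold R n M & Topological M}.

Section Manifolds.
Context {R : realType} {n : nat}.
Implicit Types M N : manifoldType R n.

Definition chart_at M (p : M) : chart R n M :=
  projT1 (cid2 (atlas_cover p)).

Definition smooth_fun_on M (U : set M) (f : M -> R) :=
  forall c : chart R n M, atlas c ->
    smooth_on (cmap c @` (cdom c `&` U)) (f \o cinv c : _ -> R^o).

Definition smooth_fun M (f : M -> R) := smooth_fun_on setT f.

Definition smooth_map M N (F : M -> N) :=
  continuous F /\
  forall (c : chart R n M) (d : chart R n N), atlas c -> atlas d ->
    smooth_on (cmap c @` (cdom c `&` F @^-1` cdom d)) (cmap d \o F \o cinv c).

(* Smoothness on products, tested in the product charts c x d. *)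
Definition smooth_fun2 M N (f : M * N -> R) :=
  forall (c : chart R n M) (d : chart R n N), atlas c -> atlas d ->
    smooth_on (cimg c `*` cimg d)
      (fun z : 'rV[R]_n * 'rV[R]_n => f (cinv c z.1, cinv d z.2) : R^o).

Definition smooth_map2 M N (P : manifoldType R n) (F : M * N -> P) :=
  continuous F /\
  forall (c : chart R n M) (d : chart R n N) (e : chart R n P),
    atlas c -> atlas d -> atlas e ->
    smooth_on
      ((cimg c `*` cimg d)
         `&` [set z | cdom e (F (cinv c z.1, cinv d z.2))])
      (fun z : 'rV[R]_n * 'rV[R]_n => cmap e (F (cinv c z.1, cinv d z.2))).

(* A tangent vector at p is given by its components in the chart [chart_at p];
   [tcoord c v] gives its components in another chart c around p.  The type
   [tangent p] unfolds to the same model space for all p, so that vectors at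
   x * 1 and at x (or at x^-1 * x and at 1) need no transport. *)
Definition tangent M (p : M) : Type := 'rV[R]_n.

Definition tcoord M (c : chart R n M) (p : M) (v : tangent p) : 'rV[R]_n :=
  'd (cmap c \o cinv (chart_at p)) (cmap (chart_at p) p) v.

Definition mdiff M N (F : M -> N) (p : M) (v : tangent p) : tangent (F p) :=
  'd (cmap (chart_at (F p)) \o F \o cinv (chart_at p)) (cmap (chart_at p) p) v.

Definition fdiff M (f : M -> R) (p : M) (v : tangent p) : R :=
  'd (f \o cinv (chart_at p) : _ -> R^o) (cmap (chart_at p) p) v.

Definition vfield M := forall p : M, tangent p.

Definition vf_coord M (c : chart R n M) (X : vfield M) (x : 'rV[R]_n)
    : 'rV[R]_n :=
  tcoord c (X (cinv c x)).

Definition smooth_vfield_on M (U : set M) (X : vfield M) :=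
  forall c : chart R n M, atlas c ->
    smooth_on (cmap c @` (cdom c `&` U)) (vf_coord c X).

Definition smooth_vfield M (X : vfield M) := smooth_vfield_on setT X.

(* [X, Y]^k = X^i d_i Y^k - Y^i d_i X^k, in the chart [chart_at p] at p. *)
Definition vf_bracket M (X Y : vfield M) : vfield M := fun p =>
  let c := chart_at p in
  'd (vf_coord c Y) (cmap c p) (X p) - 'd (vf_coord c X) (cmap c p) (Y p).

Definition metric M := forall p : M, tangent p -> tangent p -> R.

Record riemannian M (m : metric M) : Prop := {
  riem_sym : forall p u v, m p u v = m p v u;
  riem_linear : forall p (k : R) u v w,
    m p (k *: u + v) w = k * m p u w + m p v w;
  riem_pos : forall p u, u != 0 -> 0 < m p u u;
  riem_smooth : forall (U : set M) (X Y : vfield M), open U ->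
    smooth_vfield_on U X -> smooth_vfield_on U Y ->
    smooth_fun_on U (fun p => m p (X p) (Y p)) }.

Definition grad M (m : metric M) (f : M -> R) (p : M) : tangent p :=
  xget 0 [set u : tangent p | forall v : tangent p, m p u v = fdiff f v].

Record affine_connection M (nabla : vfield M -> vfield M -> vfield M)
    : Prop := {
  conn_smooth : forall X Y, smooth_vfield X -> smooth_vfield Y ->
    smooth_vfield (nabla X Y);
  connDl : forall X X' Y p,
    smooth_vfield X -> smooth_vfield X' -> smooth_vfield Y ->
    nabla (fun q => X q + X' q) Y p = nabla X Y p + nabla X' Y p;
  connZl : forall f X Y p,
    smooth_fun f -> smooth_vfield X -> smooth_vfield Y ->
    nabla (fun q => f q *: X q) Y p = f p *: nabla X Y p;
  connDr : forall X Y Y' p,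
    smooth_vfield X -> smooth_vfield Y -> smooth_vfield Y' ->
    nabla X (fun q => Y q + Y' q) p = nabla X Y p + nabla X Y' p;
  conn_leibniz : forall f X Y p,
    smooth_fun f -> smooth_vfield X -> smooth_vfield Y ->
    nabla X (fun q => f q *: Y q) p
      = fdiff f (X p) *: Y p + f p *: nabla X Y p }.

Record levi_civita M (m : metric M)
    (nabla : vfield M -> vfield M -> vfield M) : Prop := {
  lc_connection : affine_connection nabla;
  lc_torsion_free : forall X Y p, smooth_vfield X -> smooth_vfield Y ->
    nabla X Y p - nabla Y X p = vf_bracket X Y p;
  lc_metric : forall X Y Z p,
    smooth_vfield X -> smooth_vfield Y -> smooth_vfield Z ->
    fdiff (fun q => m q (Y q) (Z q)) (X p)
      = m p (nabla X Y p) (Z p) + m p (Y p) (nabla X Z p) }.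

Definition curvature M (nabla : vfield M -> vfield M -> vfield M)
    (X Y Z : vfield M) : vfield M := fun p =>
  nabla X (nabla Y Z) p - nabla Y (nabla X Z) p - nabla (vf_bracket X Y) Z p.

Definition extension M (p : M) (u : tangent p) : vfield M :=
  xget (fun=> 0) [set X : vfield M | smooth_vfield X /\ X p = u].

(* The curvature is tensorial: its value at p on tangent vectors is computed
   with arbitrary smooth vector fields extending them. *)
Definition curvature_at M (nabla : vfield M -> vfield M -> vfield M) (p : M)
    (u v w : tangent p) : tangent p :=
  curvature nabla (extension u) (extension v) (extension w) p.

(* Curves on [a, b] are functions on R of which only the restriction to [a, b]
   matters; derivatives at a and b are one-sided. *)
Definition curve_Ck M (a b : R) (k : nat) (g : R -> M) :=
  {within `[a, b], continuous g} /\
  forall c : chart R n M, atlas c ->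
    Ck_within (`[a, b] `&` g @^-1` cdom c) k (cmap c \o g).

Definition curve_smooth M (a b : R) (g : R -> M) := forall k, curve_Ck a b k g.

Definition curve_piecewise_smooth M (a b : R) (g : R -> M) :=
  exists s : seq R, [/\ path <%R a s, last a s = b &
    forall i, (i < size s)%N ->
      curve_smooth (nth a (a :: s) i) (nth a s i) g].

Definition velocity M (a b : R) (g : R -> M) (t : R) : tangent (g t) :=
  wderive `[a, b] (cmap (chart_at (g t)) \o g) t.

Definition smooth_along M (a b : R) (g : R -> M)
    (V : forall t, tangent (g t)) :=
  forall c : chart R n M, atlas c ->
    smooth_within (`[a, b] `&` g @^-1` cdom c) (fun t => tcoord c (V t)).

(* These properties determine D on smooth fields V along a smooth curve g, as
   far as the values at t in [a, b] are concerned. *)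
Record covariant_derivative M (nabla : vfield M -> vfield M -> vfield M)
    (a b : R) (g : R -> M)
    (D : (forall t, tangent (g t)) -> forall t, tangent (g t)) : Prop := {
  cd_smooth : forall V, smooth_along a b V -> smooth_along a b (D V);
  cdD : forall V W t, smooth_along a b V -> smooth_along a b W ->
    t \in `[a, b] -> D (fun s => V s + W s) t = D V t + D W t;
  cd_leibniz : forall (f : R -> R) V t,
    smooth_within `[a, b] (f : R -> R^o) -> smooth_along a b V ->
    t \in `[a, b] ->
    D (fun s => f s *: V s) t
      = wderive `[a, b] (f : R -> R^o) t *: V t + f t *: D V t;
  cd_extendible : forall X Y t, smooth_vfield X -> smooth_vfield Y ->
    t \in `[a, b] -> X (g t) = velocity a b g t ->
    D (fun s => Y (g s)) t = nabla X Y (g t) }.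

Record admissible_curve M (a b : R) (qa : M) (va : tangent qa)
    (qb : M) (vb : tangent qb) (g : R -> M) : Prop := {
  adm_C1 : curve_Ck a b 1 g;
  adm_piecewise : curve_piecewise_smooth a b g;
  adm_left : g a = qa;
  adm_right : g b = qb;
  adm_vleft : velocity a b g a = va;
  adm_vright : velocity a b g b = vb }.

End Manifolds.

HB.mixin Record isLieGroup (R : realType) (n : nat) G
    of Manifold R n G & Group G := {
  lie_mul_smooth : smooth_map2 (fun z : G * G => (z.1 * z.2)%g);
  lie_inv_smooth : smooth_map (fun x : G => (x^-1)%g) }.

#[short(type="lieGroupType")]
HB.structure Definition LieGroup (R : realType) (n : nat) :=
  {G of isLieGroup R n G & Manifold R n G & Group G}.

Section LieGroups.
Context {R : realType} {n : nat} {G : lieGroupType R n}.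

Local Notation e := (1%g : G).

Definition Lmul (x y : G) : G := (x * y)%g.

Definition left_invariant (m : metric G) :=
  forall (x p : G) (u v : tangent p),
    m (Lmul x p) (mdiff (Lmul x) u) (mdiff (Lmul x) v) = m p u v.

(* The left-invariant vector field extending xi. *)
Definition phi (xi : tangent e) : vfield G := fun x => mdiff (Lmul x) xi.

Definition lie_bracket (xi zeta : tangent e) : tangent e :=
  vf_bracket (phi xi) (phi zeta) e.

(* <ad_dagger xi eta, zeta> = <eta, [xi, zeta]> for all zeta. *)
Definition ad_dagger (m : metric G) (xi eta : tangent e) : tangent e :=
  xget 0 [set u : tangent e |
           forall zeta : tangent e, m e u zeta = m e eta (lie_bracket xi zeta)].

Definition conn_alg (nabla : vfield G -> vfield G -> vfield G)
    (xi eta : tangent e) : tangent e :=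
  nabla (phi xi) (phi eta) e.

(* The curve g^-1 g' in the Lie algebra. *)
Definition left_velocity (a b : R) (g : R -> G) (t : R) : tangent e :=
  mdiff (Lmul (g t)^-1%g) (velocity a b g t).

End LieGroups.

(* Main.v *)
(* Left translation identifies fields along g with curves in the Lie algebra: a
   field is phi(u)(g) for a unique curve u, and expanding u in a left-invariant
   frame gives D_t (phi(u)(g)) = phi(u' + nabla_xi u)(g), because the connection
   of two left-invariant fields is left-invariant (Koszul's formula, the bracket
   being left-invariant by the symmetry of second derivatives).  The same
   formula yields nabla_xi xi = - ad^dagger_xi xi.  Hence D_t g' = phi(eta)(g) with
   eta = xi' - ad^dagger_xi xi, and two more derivatives, with
   (nabla_xi eta)' = nabla_{xi'} eta + nabla_xi eta', give the displayed terms.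
   The curvature is tensorial and left-invariant, and
   V = Vext(g0^-1 . , e) turns grad V into the left-translated gradient of the
   first argument of Vext, so both equations say that the same curve in the Lie
   algebra vanishes. *)
Require Import Defs.
From HB Require Import structures.
From mathcomp Require Import all_boot all_order all_algebra.
From mathcomp Require Import all_classical all_reals all_analysis.
From mathcomp Require Import ring lra.
Import Order.TTheory GRing.Theory Num.Theory.
Import numFieldNormedType.Exports.

Set Implicit Arguments.
Unset Strict Implicit.
Unset Printing Implicit Defensive.

Local Open Scope classical_set_scope.
Local Open Scope ring_scope.

(** * Differentials and the symmetry of second derivatives *)

(** The connection, the covariant derivative and the curvature are given only by axioms on fields
    defined on all of G or along the whole curve, while smoothness and the bracket are given only in
    charts. What links the two is that left-invariant coordinates of a smooth field are smooth
    functions on all of G: they are inner products with the frame, corrected by a constant matrix.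
    Every field is thus a finite sum to which the axioms apply, and no localisation of the axioms is
    required. The remaining work is local: chain and product rules for Frechet differentials, whose
    chart expressions agree with the intended composites only near a point, and for derivatives
    taken within [a, b], which are one-sided at the ends. The curve g may leave a chart, so
    smoothness in t is shown on relatively open sets of times and then glued. *)

Section DiffComplements.
Context {R : realType}.
Implicit Types V W : normedModType R.

(** Since [cinv] is arbitrary off the image of a chart, chart expressions satisfy the expected
    identities only near a point; this carries differentials across such local equalities. *)
Lemma near_eq_is_diff V W (f g df : V -> W) (x : V) :
  (\forall y \near x, f y = g y) -> is_diff x f df -> is_diff x g df.
Proof.
move=> fg [fx dfE].
have gx : f x = g x by exact: nbhs_singleton fg.
have gE : g \o shift x = cst (g x) + 'd f x +o_ 0 id.
  apply/eqaddoP => e e0; have /eqaddoP /(_ e e0) := diff_locally fx.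
  apply: filter_app.
  have : \forall y \near (0 : V), f (y + x) = g (y + x).
    by have := fg; rewrite (near_shift 0 x) /= subr0.
  by apply: filterS => y; rewrite !fctE /= => <-; rewrite gx.
have cdf : continuous ('d f x) by exact: diff_continuous.
have E := diff_unique cdf gE.
split; last by rewrite E.
by apply/diff_locallyP; rewrite E; split.
Qed.

Lemma differentiable_bound V W (f : V -> W) (x : V) : differentiable f x ->
  forall e : R, 0 < e ->
  \forall h \near (0 : V), `|f (x + h) - f x - 'd f x h| <= e * `|h|.
Proof.
move=> fx e e0; have /eqaddoP /(_ e e0) := diff_locally fx.
by apply: filterS => h; rewrite !fctE /= opprD addrA addrC [h + x]addrC addrA
  [- _ + _]addrC addrAC.
Qed.

Lemma diff_scale V W (f df : V -> R^o) (g dg : V -> W) (x : V) :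
  is_diff x f df -> is_diff x g dg ->
  is_diff x (fun y => f y *: g y) (fun v => df v *: g x + f x *: dg v).
Proof.
move=> fx gx.
have bil : bilinear_for (GRing.Scale.Law.clone _ _ *:%R _)
    (GRing.Scale.Law.clone _ _ *:%R _) (fun (k : R^o) (w : W) => k *: w).
  split=> [u'|u] a y z /=; first by rewrite scalerDl scalerA.
  by rewrite scalerDr !scalerA mulrC.
(* Scaling is packed as a continuous bilinear map, so that the product rule is the chain rule
   applied to y |-> (f y, g y). *)
pose B : {bilinear R^o -> W -> W} := HB.pack (fun (k : R^o) (w : W) => k *: w)
  (bilinear_isBilinear.Build R R^o W W _ _ _ bil).
have Bc : continuous (fun p : R^o * W => B p.1 p.2) by exact: scale_continuous.
have dB := diff_bilin (f x, g x) Bc.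
have Bx := differentiable_bilin (f x, g x) Bc.
have P := is_diff_pair fx gx.
have Q : is_diff ((fun y => (f y, g y)) x) (fun p : R^o * W => B p.1 p.2)
    (fun q => B (f x, g x).1 q.2 + B q.1 (f x, g x).2).
  by split; [exact: Bx|exact: dB].
have := is_diff_comp P Q; rewrite /comp /= => H.
by apply: is_diff_eq H _; apply/funext => v /=; rewrite addrC.
Qed.

Lemma is_diff_linear V W (L : {linear V -> W}) (x : V) :
  continuous L -> is_diff x L L.
Proof. by move=> Lc; split; [exact: linear_differentiable|exact: diff_lin]. Qed.

(* By the mean value theorem in the direction u, the second difference
   f(x + su + sv) - f(x + su) - f(x + sv) + f(x) is s times the difference of
   'd f u between two points which are s v apart; its quotient by s^2 therefore
   tends to the derivative of 'd f u along v. *)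
Lemma second_difference V (f : V -> R^o) (x u v : V) :
  (\forall y \near x, differentiable f y) ->
  differentiable (fun y => 'd f y u : R^o) x ->
  forall e : R, 0 < e -> \forall s \near (0 : R)^'+,
    `|f (x + s *: u + s *: v) - f (x + s *: u) - f (x + s *: v) + f x
      - s * s * 'd (fun y => 'd f y u : R^o) x v| <= e * (s * s).
Proof.
move=> df dg e e0; set g := fun y => 'd f y u : R^o.
(* The displacements th u + s v and th u used below have norms adding up to at most s (2|u| + |v|);
   the extra 1 keeps [K] positive. *)
pose K := 2 * `|u| + `|v| + 1.
have K0 : 0 < K by rewrite ltr_wpDl// addr_ge0// mulr_ge0.
have /nbhs_ballP[d /= d0 near0] : \forall h \near (0 : V),
    differentiable f (x + h) /\ `|g (x + h) - g x - 'd g x h| <= e / K * `|h|.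
  apply: filterI; last by apply: differentiable_bound => //; rewrite divr_gt0.
  have := df; rewrite (near_shift 0 x) /= subr0.
  by apply: filterS => h /=; rewrite addrC.
have small h : `|h| < d -> differentiable f (x + h) /\
    `|g (x + h) - g x - 'd g x h| <= e / K * `|h|.
  by move=> hd; apply: near0; rewrite -ball_normE /= sub0r normrN.
near=> s.
have s0 : 0 < s by near: s; exact: nbhs_right_gt.
have sd : s * K < d.
  by rewrite -ltr_pdivlMr//; near: s; apply: nbhs_right_lt; rewrite divr_gt0.
(* The boolean [i] selects the segment shifted by s v or the unshifted one, so that both are handled
   together. *)
have norm_le (i : bool) th : th \in `[0, s] ->
    `|th *: u + (if i then s else 0) *: v| <= s * (`|u| + (if i then `|v| else 0)).
  rewrite in_itv /= => /andP[th0 ths].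
  rewrite (le_trans (ler_normD _ _))// mulrDr lerD// normrZ.
    by rewrite ger0_norm// ler_wpM2r.
  by case: i; rewrite ?normr0 ?mul0r ?mulr0// gtr0_norm.
have le_d (i : bool) th : th \in `[0, s] ->
    `|th *: u + (if i then s else 0) *: v| < d.
  move=> /(norm_le i)/le_lt_trans; apply; rewrite (le_lt_trans _ sd)//.
  apply: ler_wpM2l; [exact: ltW|rewrite /K]; have := normr_ge0 u; have := normr_ge0 v.
  by case: i; lra.
have der (i : bool) th : th \in `[0, s] ->
    is_diff th (fun t : R => f (x + (t *: u + (if i then s else 0) *: v)))
      (fun k : R => 'd f (x + (th *: u + (if i then s else 0) *: v)) (k *: u)).
  move=> ths; set w := (if i then s else 0) *: v.
  pose A := (fun t : R => x + (t *: u + w)).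
  have dA : is_diff th A (fun k : R => k *: u).
    have -> : A = cst x + (( *:%R ^~ u) + cst w) by [].
    have := is_diffD (is_diff_cst x th)
      (is_diffD (is_diff_scalel th u) (is_diff_cst w th)).
    by move=> H; apply: (is_diff_eq H); rewrite addr0 add0r.
  have [dfA _] := small _ (le_d i _ ths).
  have dfA' : is_diff (A th) f ('d f (A th)) := differentiableP dfA.
  exact: is_diff_comp dA dfA'.
pose ph t := f (x + (t *: u + s *: v)) - f (x + (t *: u + 0 *: v)).
pose dph t := g (x + (t *: u + s *: v)) - g (x + (t *: u + 0 *: v)).
have dphE th : th \in `[0, s] -> is_diff th ph (fun k => k *: dph th).
  move=> ths; have := is_diffB (der true _ ths) (der false _ ths).
  move=> H; apply: (is_diff_eq H); apply/funext => k.
  have E y : 'd f y (k *: u) = k *: 'd f y u by rewrite linearZ.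
  by rewrite /dph /g !fctE /= !E scalerBr.
have /(MVT s0)[] : forall t, t \in `]0, s[ -> is_derive t 1 ph (dph t).
- move=> t ts; have tcc : t \in `[0, s] by exact: subset_itv_oo_cc.
  have [pht E] := dphE _ tcc.
  by split; [exact: diff_derivable|rewrite deriveE// E scale1r].
- apply/continuous_within_itvP => //; split.
  + move=> t ts; have tcc : t \in `[0, s] by exact: subset_itv_oo_cc.
    by apply: differentiable_continuous; have [] := dphE _ tcc.
  + apply: cvg_at_right_filter; apply: differentiable_continuous.
    by have [] := dphE 0 _; rewrite ?in_itv/= ?lexx ?ltW.
  + apply: cvg_at_left_filter; apply: differentiable_continuous.
    by have [] := dphE s _; rewrite ?in_itv/= ?lexx ?ltW.
move=> th thoo; rewrite subr0 => E.
have thcc : th \in `[0, s] by exact: subset_itv_oo_cc.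
have -> : f (x + s *: u + s *: v) - f (x + s *: u) - f (x + s *: v) + f x =
    ph s - ph 0.
  by rewrite /ph !scale0r !add0r !addr0 !addrA opprB addrA addrAC.
have [_ b1] := small _ (le_d true _ thcc).
have [_ b0] := small _ (le_d false _ thcc).
have -> : ph s - ph 0 - s * s * 'd g x v = (dph th - s * 'd g x v) * s.
  by rewrite E; ring.
rewrite normrM (gtr0_norm s0) mulrA ler_pM2r//.
(* Both values of [g] are compared with the linearisation of [g] at x; the contributions of th u
   cancel, so nothing more has to be known about th. *)
have -> : dph th - s * 'd g x v =
    (g (x + (th *: u + s *: v)) - g x - 'd g x (th *: u + s *: v))
    - (g (x + (th *: u + 0 *: v)) - g x - 'd g x (th *: u + 0 *: v)).
  rewrite scale0r addr0 /dph scale0r addr0 !linearD !linearZ /=.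
  by ring.
rewrite (le_trans (ler_normB _ _))// (le_trans (lerD b1 b0))//.
rewrite -mulrDr (_ : e * s = e / K * (s * K)); last by field; rewrite gt_eqF.
apply: ler_wpM2l; first by rewrite divr_ge0// ltW.
apply: (le_trans (lerD (norm_le true _ thcc) (norm_le false _ thcc))).
rewrite -mulrDr addr0 /K; apply: ler_wpM2l; first exact: ltW.
by have := normr_ge0 u; have := normr_ge0 v; lra.
Unshelve. all: by end_near.
Qed.

(** The second difference is symmetric in u and v, so it lies within e/2 s^2 of s^2 times either
    iterated differential; dividing by s^2 bounds their distance by e. *)
Lemma diff_diff_sym V (f : V -> R^o) (x u v : V) :
  (\forall y \near x, differentiable f y) ->
  differentiable (fun y => 'd f y u : R^o) x ->
  differentiable (fun y => 'd f y v : R^o) x ->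
  'd (fun y => 'd f y u : R^o) x v = 'd (fun y => 'd f y v : R^o) x u.
Proof.
move=> df du dv; apply/eqP; rewrite -subr_eq0 -normr_le0.
apply/ler_addgt0Pl => e e0; rewrite addr0.
have e2 : 0 < e / 2 by rewrite divr_gt0.
near (0 : R)^'+ => s.
have s0 : 0 < s by near: s; exact: nbhs_right_gt.
have Bu : `|f (x + s *: u + s *: v) - f (x + s *: u) - f (x + s *: v) + f x
    - s * s * 'd (fun y => 'd f y u : R^o) x v| <= e / 2 * (s * s).
  by near: s; exact: second_difference.
have Bv : `|f (x + s *: v + s *: u) - f (x + s *: v) - f (x + s *: u) + f x
    - s * s * 'd (fun y => 'd f y v : R^o) x u| <= e / 2 * (s * s).
  by near: s; exact: second_difference.
have ss0 : 0 < s * s by rewrite mulr_gt0.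
rewrite -(ler_pM2l ss0) -{1}(gtr0_norm ss0) -normrM.
rewrite mulrBr; move: Bu Bv.
rewrite addrAC [x + s *: v + s *: u]addrAC.
set a := s * s * 'd _ x v; set b := s * s * 'd _ x u.
rewrite !ler_norml; lra.
Unshelve. all: by end_near.
Qed.

End DiffComplements.

(** * Maps of class C^k on open sets *)

Section CkOn.
Context {R : realType}.
Implicit Types V W : normedModType R.

Lemma is_diffE V W (f df : V -> W) x v : is_diff x f df -> 'd f x v = df v.
Proof. by move=> H; rewrite diff_val. Qed.

Lemma is_diff_bigsum V W (I : Type) (r : seq I) (P : pred I)
    (f df : I -> V -> W) (x : V) :
  (forall i, is_diff x (f i) (df i)) ->
  is_diff x (fun y => \sum_(i <- r | P i) f i y)
            (fun v => \sum_(i <- r | P i) df i v).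
Proof.
move=> H; rewrite -!fct_sumE.
elim/big_ind2 : _ => [|a b c d aE cE|i _]; last exact: H.
  exact: is_diff_cst.
exact: is_diffD aE cE.
Qed.

Lemma is_diff_lin_comp V W (W' : normedModType R) (L : {linear W -> W'})
    (f df : V -> W) (x : V) :
  continuous L -> is_diff x f df -> is_diff x (L \o f) (L \o df).
Proof.
move=> Lc fx; have Lx := is_diff_linear (f x) Lc.
exact: is_diff_comp fx Lx.
Qed.

(** [Ck_on] speaks of differentials in fixed directions only; this reduces a direction that varies
    with the point to the finitely many basis directions. *)
Lemma diff_row_sum n W (f : 'rV[R]_n -> W) x v :
  'd f x v = \sum_j v 0 j *: 'd f x (delta_mx 0 j).
Proof.
rewrite {1}[v]row_sum_delta linear_sum /=; apply: eq_bigr => j _.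
by rewrite linearZ.
Qed.

Lemma is_diff_coord V n (f df : V -> 'rV[R]_n) (x : V) j :
  is_diff x f df ->
  is_diff x (fun y => f y 0 j : R^o) (fun v => df v 0 j).
Proof.
move=> fx; pose L : {linear 'rV[R]_n -> R^o} := HB.pack
  (fun v : 'rV[R]_n => v 0 j : R^o) (GRing.isLinear.Build _ _ _ _
    (fun v : 'rV[R]_n => v 0 j : R^o) (fun a u v => etrans (mxE _ _ _ _)
      (congr1 (+%R^~ (v 0 j)) (mxE _ _ _ _)))).
have Lc : continuous L by exact: coord_continuous.
exact: is_diff_lin_comp Lc fx.
Qed.

Lemma Ck_on_sub V W (U U' : set V) k (f : V -> W) :
  U' `<=` U -> Ck_on U k f -> Ck_on U' k f.
Proof.
move=> UU'; elim: k f => [|k IH] f /=; first by move=> H x /UU'; exact: H.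
by move=> [H1 H2]; split=> [x /UU'|v]; [exact: H1|exact: IH].
Qed.

Lemma Ck_on_eq V W (U : set V) k (f g : V -> W) : open U ->
  (forall x, U x -> f x = g x) -> Ck_on U k f -> Ck_on U k g.
Proof.
move=> oU; elim: k f g => [|k IH] f g fg /=.
  move=> H x Ux; have nU : nbhs x U by exact: open_nbhs_nbhs.
  have gx : g @ x --> f x.
    by apply: cvg_trans (H x Ux); apply: near_eq_cvg; apply: filterS nU => y /fg.
  by rewrite (fg _ Ux) in gx.
have fgx x : U x -> \forall y \near x, f y = g y.
  by move=> Ux; apply: filterS (open_nbhs_nbhs (conj oU Ux)) => y /fg.
move=> [H1 H2]; split=> [x Ux|v].
  by have [] := near_eq_is_diff (fgx x Ux) (differentiableP (H1 x Ux)).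
apply: IH (H2 v) => x Ux.
have H := near_eq_is_diff (fgx x Ux) (differentiableP (H1 x Ux)).
by rewrite [in RHS](diff_val).
Qed.

(** The inductive step of the closure properties below: an explicit formula for the differential
    takes the place of ['d]. *)
Lemma Ck_on_is_diff V W (U : set V) k (f : V -> W) (df : V -> V -> W) :
  open U -> (forall x, U x -> is_diff x f (df x)) ->
  (forall v, Ck_on U k (df^~ v)) -> Ck_on U k.+1 f.
Proof.
move=> oU fdf H; split=> [x /fdf[]//|v].
apply: Ck_on_eq oU _ (H v) => x /fdf dfx.
by rewrite [in RHS](diff_val).
Qed.

Lemma Ck_onS V W (U : set V) k (f : V -> W) : Ck_on U k.+1 f -> Ck_on U k f.
Proof.
elim: k f => [|k IH] f [H1 H2]; last by split=> // v; exact: IH.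
by move=> x /H1; exact: differentiable_continuous.
Qed.

Lemma Ck_on_cst V W (U : set V) k (w : W) : Ck_on U k (fun _ : V => w).
Proof.
elim: k w => [|k IH] w /=; first by move=> x _; exact: cst_continuous.
split=> [x _|v]; first exact: differentiable_cst.
have -> : (fun x => 'd (fun _ : V => w) x v) = (fun=> 0); last exact: IH.
by apply/funext => x; exact: (congr1 (@^~ v) (@diff_cst R V W w x)).
Qed.

Lemma Ck_onD V W (U : set V) k (f g : V -> W) : open U ->
  Ck_on U k f -> Ck_on U k g -> Ck_on U k (fun x => f x + g x).
Proof.
move=> oU; elim: k f g => [|k IH] f g /=.
  by move=> fc gc x Ux; apply: continuousD; [exact: fc|exact: gc].
move=> [f1 f2] [g1 g2].
apply: (Ck_on_is_diff (df := fun x v => 'd f x v + 'd g x v)) => //.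
  move=> x Ux; exact: (is_diffD (differentiableP (f1 x Ux)) (differentiableP (g1 x Ux))).
by move=> v; exact: (IH _ _ (f2 v) (g2 v)).
Qed.

Lemma Ck_onZ V W (U : set V) k (f : V -> R^o) (g : V -> W) : open U ->
  Ck_on U k f -> Ck_on U k g -> Ck_on U k (fun x => f x *: g x).
Proof.
move=> oU; elim: k f g => [|k IH] f g.
  move=> fc gc x Ux; exact: (cvgZ (fc x Ux) (gc x Ux)).
move=> Sf Sg; have [f1 f2] := Sf; have [g1 g2] := Sg.
apply: (Ck_on_is_diff (df := fun x v => 'd f x v *: g x + f x *: 'd g x v)) => //.
  move=> x Ux; exact: (diff_scale (differentiableP (f1 x Ux)) (differentiableP (g1 x Ux))).
move=> v; apply: (Ck_onD oU).
  exact: (IH (fun x => 'd f x v) g (f2 v) (Ck_onS Sg)).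
exact: (IH f (fun x => 'd g x v) (Ck_onS Sf) (g2 v)).
Qed.

Lemma Ck_on_sum V W (U : set V) k (I : Type) (r : seq I) (P : pred I)
    (f : I -> V -> W) : open U -> (forall i, Ck_on U k (f i)) ->
  Ck_on U k (fun x => \sum_(i <- r | P i) f i x).
Proof.
move=> oU H; rewrite -fct_sumE; elim/big_ind : _ => [|a b|//].
  exact: Ck_on_cst.
exact: Ck_onD.
Qed.

Lemma Ck_on_coord V n (U : set V) k (f : V -> 'rV[R]_n) j : open U ->
  Ck_on U k f -> Ck_on U k (fun x => f x 0 j : R^o).
Proof.
move=> oU; elim: k f => [|k IH] f.
  move=> fc x Ux.
  have := @coord_continuous _ 1 n 0 j (f x).
  by apply: continuous_comp; exact: fc.
move=> [f1 f2]; apply: (Ck_on_is_diff (df := fun x v => 'd f x v 0 j)) => //.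
  by move=> x Ux; apply: is_diff_coord; exact: differentiableP (f1 _ Ux).
by move=> v; exact: (IH _ (f2 v)).
Qed.

(** Serves the insertions of a factor into a product, whose target is not a row space as in
    [Ck_on_comp]. The differential [L] of [A] does not depend on the point, so a fixed direction v
    stays the fixed direction L v. *)
Lemma Ck_on_comp_affine V W (V' : normedModType R) (A L : V' -> V)
    (U : set V) k (f : V -> W) :
  open U -> open (A @^-1` U) -> (forall x, is_diff x A L) ->
  Ck_on U k f -> Ck_on (A @^-1` U) k (f \o A).
Proof.
move=> oU oA dA; elim: k f => [|k IH] f.
  move=> fc x Ux; apply: continuous_comp; last exact: fc.
  by apply: differentiable_continuous; have [] := dA x.
move=> [f1 f2]; apply: (Ck_on_is_diff (df := fun x v => 'd f (A x) (L v))) => //.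
  move=> x Ux; have fx := differentiableP (f1 (A x) Ux).
  exact: (is_diff_comp (dA x) fx).
by move=> v; exact: (IH _ (f2 (L v))).
Qed.

Lemma Ck_on_comp V W n (U : set V) (U' : set 'rV[R]_n) k
    (f : 'rV[R]_n -> W) (g : V -> 'rV[R]_n) : open U -> open U' ->
  (forall x, U x -> U' (g x)) ->
  Ck_on U' k f -> Ck_on U k g -> Ck_on U k (f \o g).
Proof.
move=> oU oU' gU; elim: k f g gU => [|k IH] f g gU.
  by move=> fc gc x Ux; apply: continuous_comp; [exact: gc|exact/fc/gU].
move=> [f1 f2] Sg; have [g1 g2] := Sg.
apply: (Ck_on_is_diff (df := fun x v =>
    \sum_j 'd g x v 0 j *: 'd f (g x) (delta_mx 0 j))) => //.
  move=> x Ux; have gx := differentiableP (g1 _ Ux).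
  have fx := differentiableP (f1 _ (gU _ Ux)).
  apply: is_diff_eq (is_diff_comp gx fx) _.
  by apply/funext => v /=; rewrite diff_row_sum.
move=> v; apply: (Ck_on_sum (f := fun j x =>
  ('d g x v 0 j : R^o) *: 'd f (g x) (delta_mx 0 j)) _ _ oU) => j.
apply: (Ck_onZ (f := fun x => 'd g x v 0 j : R^o)
  (g := (fun y => 'd f y (delta_mx 0 j)) \o g) oU).
  exact: (Ck_on_coord j oU (g2 v)).
exact: (IH (fun y => 'd f y (delta_mx 0 j)) g gU (f2 _) (Ck_onS Sg)).
Qed.

Lemma diff_diff_row_sym n m (f : 'rV[R]_n -> 'rV[R]_m) (U : set 'rV[R]_n) x u v :
  open U -> U x -> Ck_on U 2 f ->
  'd (fun y => 'd f y u) x v = 'd (fun y => 'd f y v) x u.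
Proof.
move=> oU Ux [f1 f2]; apply/rowP => j.
have fj y : U y -> is_diff y (fun y => f y 0 j : R^o) (fun w => 'd f y w 0 j).
  by move=> Uy; apply: is_diff_coord; exact: differentiableP (f1 _ Uy).
have nU := open_nbhs_nbhs (conj oU Ux).
have fjw w : is_diff x (fun y => 'd (fun y => f y 0 j : R^o) y w : R^o)
    (fun h => 'd (fun y => 'd f y w) x h 0 j).
  have [f2w _] := f2 w.
  apply: near_eq_is_diff (is_diff_coord j (differentiableP (f2w _ Ux))).
  by apply: filterS nU => y /fj dfy; exact: esym (is_diffE w dfy).
have S : 'd (fun y => 'd (fun y => f y 0 j : R^o) y u : R^o) x v =
         'd (fun y => 'd (fun y => f y 0 j : R^o) y v : R^o) x u.
  apply: diff_diff_sym; [|exact: (@ex_diff _ _ _ _ _ _ _ (fjw u))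
                         |exact: (@ex_diff _ _ _ _ _ _ _ (fjw v))].
  by apply: filterS nU => y /fj[].
exact: etrans (esym (is_diffE v (fjw u))) (etrans S (is_diffE u (fjw v))).
Qed.

(** Expanding Y in coordinates leaves differentials in fixed directions, to which the product rule
    for scaling applies. *)
Lemma is_diff_diff n W (f : 'rV[R]_n -> W) (Y dY : 'rV[R]_n -> 'rV[R]_n)
    (U : set 'rV[R]_n) x :
  open U -> U x -> Ck_on U 2 f -> is_diff x Y dY ->
  is_diff x (fun y => 'd f y (Y y))
    (fun h => 'd f x (dY h) + 'd (fun y => 'd f y (Y x)) x h).
Proof.
move=> oU Ux [f1 f2] dYx.
have H j : is_diff x (fun y => (Y y 0 j : R^o) *: 'd f y (delta_mx 0 j))
   (fun h => (dY h 0 j : R^o) *: 'd f x (delta_mx 0 j)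
           + (Y x 0 j : R^o) *: 'd (fun y => 'd f y (delta_mx 0 j)) x h).
  have [f2j _] := f2 (delta_mx 0 j).
  exact: (diff_scale (is_diff_coord j dYx) (differentiableP (f2j _ Ux))).
have C j : is_diff x (fun y => (Y x 0 j : R^o) *: 'd f y (delta_mx 0 j))
    (fun h => (Y x 0 j : R^o) *: 'd (fun y => 'd f y (delta_mx 0 j)) x h).
  have [f2j _] := f2 (delta_mx 0 j).
  exact: (is_diffZ (Y x 0 j) (differentiableP (f2j _ Ux))).
have -> : (fun y => 'd f y (Y y)) =
    (fun y => \sum_j (Y y 0 j : R^o) *: 'd f y (delta_mx 0 j)).
  by apply/funext => y; rewrite diff_row_sum.
have -> : (fun y => 'd f y (Y x)) =
    (fun y => \sum_j (Y x 0 j : R^o) *: 'd f y (delta_mx 0 j)).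
  by apply/funext => y; rewrite diff_row_sum.
have := is_diff_bigsum (index_enum 'I_n) xpredT H => D; apply: (is_diff_eq D).
have := is_diff_bigsum (index_enum 'I_n) xpredT C => E.
apply/funext => h; rewrite big_split /=; congr (_ + _).
  by rewrite [RHS]diff_row_sum.
exact: esym (is_diffE h E).
Qed.

(** The second-order terms cancel by symmetry and the first-order ones form the coordinate
    expression of the bracket. Symmetry is a hypothesis so that W can be the scalars in one use and
    a row space in another. *)
Lemma diff_bracket n W (f : 'rV[R]_n -> W) (X Y : 'rV[R]_n -> 'rV[R]_n)
    (U : set 'rV[R]_n) x :
  open U -> U x -> Ck_on U 2 f ->
  (forall u v, 'd (fun y => 'd f y u) x v = 'd (fun y => 'd f y v) x u) ->
  differentiable X x -> differentiable Y x ->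
  'd (fun y => 'd f y (Y y)) x (X x) - 'd (fun y => 'd f y (X y)) x (Y x) =
  'd f x ('d Y x (X x) - 'd X x (Y x)).
Proof.
move=> oU Ux f2 sym /differentiableP dX /differentiableP dY.
have HX := is_diff_diff oU Ux f2 dX; have HY := is_diff_diff oU Ux f2 dY.
apply: etrans (congr2 (fun a b => a - b) (is_diffE (X x) HY) (is_diffE (Y x) HX)) _.
have K (a b c d : W) : c = d -> a + c - (b + d) = a - b.
  by move=> ->; rewrite opprD addrACA subrr addr0.
apply: etrans (K _ _ _ _ (sym (Y x) (X x))) _.
exact: (esym (linearB ('d f x) _ _)).
Qed.

End CkOn.

(** * Curves of class C^k on an interval *)

Section Curves.
Context {R : realType} (I : set R).
Hypothesis I_limit : forall t, I t -> ProperFilter (within I t^').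
Implicit Types V W : normedModType R.

Definition is_wder V (f : R -> V) (t : R) (l : V) :=
  wquot f t s @[s --> within I t^'] --> l.

(** The typical J is the set of times at which a curve lies in the domain of a chart. *)
Definition relopen (J : set R) :=
  J `<=` I /\ forall t, J t -> \forall s \near t, I s -> J s.

(* Unlike in Ck_within J k f, every derivative is taken within I, so that the
   condition is pointwise in J and can be glued. *)
Fixpoint Ck_rel V (J : set R) (k : nat) (f : R -> V) : Prop :=
  if k is k'.+1 then
    (forall t, J t -> wderivable I f t) /\ Ck_rel J k' (wderive I f)
  else forall t, J t -> f @ within I (nbhs t) --> f t.

Lemma is_wderE V (f : R -> V) t l : I t -> is_wder f t l -> wderive I f t = l.
Proof. by move=> It H; have PF := I_limit It; exact: (cvg_lim (@norm_hausdorff _ _) H). Qed.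

Lemma wderivableP V (f : R -> V) t : wderivable I f t -> is_wder f t (wderive I f t).
Proof. by []. Qed.

Lemma is_wder_derivable V (f : R -> V) t l : is_wder f t l -> wderivable I f t.
Proof. by move=> H; apply/cvg_ex; exists l. Qed.

(** Cleared of its denominator, the estimate also makes sense at s = t, so the punctured
    neighbourhood disappears. *)
Lemma is_wderP V (f : R -> V) t l : is_wder f t l <->
  forall e : R, 0 < e -> \forall s \near t, I s ->
    `|f s - f t - (s - t) *: l| <= e * `|s - t|.
Proof.
have H s : s != t -> `|l - wquot f t s| = `|f s - f t - (s - t) *: l| / `|s - t|.
  rewrite -subr_eq0 => st; rewrite /wquot -normfV mulrC -normrZ.
  by rewrite [in RHS]scalerBr scalerA mulVf// scale1r distrC.
rewrite /is_wder; split=> [/cvgrPdist_le E e e0|E].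
  have := E e e0; rewrite !near_withinE; apply: filterS => s E1 Is.
  have [->|st] := eqVneq s t; first by rewrite !subrr scale0r subrr !normr0 mulr0.
  by have := E1 st Is; rewrite H// ler_pdivrMr// normr_gt0 subr_eq0.
apply/cvgrPdist_le => e e0; have := E e e0.
rewrite !near_withinE; apply: filterS => s E1 st Is; rewrite H//.
by rewrite ler_pdivrMr ?normr_gt0 ?subr_eq0//; exact: E1.
Qed.

Lemma is_wder_eq V (f g : R -> V) t l : (\forall s \near t, I s -> f s = g s) ->
  I t -> is_wder f t l -> is_wder g t l.
Proof.
move=> fg It /is_wderP H; apply/is_wderP => e e0.
have ft : f t = g t by have := nbhs_singleton fg; exact.
apply: filterS2 fg (H e e0) => s fgs Hs Is.
by rewrite -ft -fgs//; exact: Hs.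
Qed.

Lemma is_wder_continuous V (f : R -> V) t l :
  is_wder f t l -> f @ within I (nbhs t) --> f t.
Proof.
move=> /is_wderP H; apply/cvgrPdist_le => e e0; rewrite near_withinE.
have L : 0 < `|l| + 1 by rewrite ltr_wpDl.
have st : \forall s \near t, `|t - s| <= e / (`|l| + 1).
  have : (fun s : R => s) @ t --> t by exact: cvg_id.
  by move=> /cvgrPdist_le; apply; rewrite divr_gt0.
apply: filterS2 st (H 1 ltr01) => s; rewrite ler_pdivlMr// distrC => st Hs /Hs.
rewrite mul1r => {}Hs; apply: (le_trans _ st); rewrite (distrC (f t)).
rewrite -[f s - f t](subrK ((s - t) *: l)) (le_trans (ler_normD _ _))//.
by rewrite normrZ mulrDr mulr1 addrC lerD2l.
Qed.

Lemma is_wder_comp V W (f df : V -> W) (c : R -> V) t l :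
  is_wder c t l -> is_diff (c t) f df -> is_wder (f \o c) t (df l).
Proof.
move=> cl [dfc <-]; apply/is_wderP => e e0.
have cc := is_wder_continuous cl; move/is_wderP: cl => cl.
have [K K0 LK] := linear_lipschitz (diff_continuous dfc).
(* The bound 1 in [e2] makes c Lipschitz at t with constant |l| + 1, so the remainder of f costs e1
   (|l| + 1) = e/2; the remainder of c passes through the differential, of Lipschitz constant K, and
   costs K e2 <= e/2. *)
pose e1 := e / 2 / (`|l| + 1); pose e2 := Num.min 1 (e / 2 / K).
have L0 : 0 < `|l| + 1 by rewrite ltr_wpDl.
have e10 : 0 < e1 by rewrite !divr_gt0.
have e20 : 0 < e2 by rewrite lt_min ltr01 !divr_gt0.
have near1 : \forall s \near t, I s ->
    `|f (c s) - f (c t) - 'd f (c t) (c s - c t)| <= e1 * `|c s - c t|.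
  have H : \forall x \near c t,
      `|f x - f (c t) - 'd f (c t) (x - c t)| <= e1 * `|x - c t|.
    rewrite (near_shift 0 (c t)); apply: filterS (differentiable_bound dfc e10).
    by move=> h /=; rewrite subr0 addrK [h + _]addrC.
  exact: (cc _ H).
apply: filterS2 near1 (cl e2 e20) => s + + Is => /(_ Is) H1 /(_ Is) H2.
have <- : 'd f (c t) ((s - t) *: l) = (s - t) *: 'd f (c t) l by rewrite linearZ.
have -> : f (c s) - f (c t) - 'd f (c t) ((s - t) *: l) =
    (f (c s) - f (c t) - 'd f (c t) (c s - c t)) +
    'd f (c t) (c s - c t - (s - t) *: l).
  by rewrite [in RHS](linearB ('d f (c t)) (c s - c t)) addrA subrK.
have H3 : `|c s - c t| <= (`|l| + 1) * `|s - t|.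
  rewrite -[c s - c t](subrK ((s - t) *: l)) (le_trans (ler_normD _ _))//.
  rewrite normrZ addrC mulrDl mul1r [`|l| * _]mulrC lerD2l (le_trans H2)//.
  by rewrite ler_piMl// ge_min lexx.
rewrite (le_trans (ler_normD _ _))// (splitr e) mulrDl lerD//.
  rewrite (le_trans H1)//; apply: le_trans (ler_wpM2l (ltW e10) H3) _.
  by rewrite mulrA /e1 divfK// gt_eqF.
rewrite (le_trans (LK _))//; apply: le_trans (ler_wpM2l (ltW K0) H2) _.
rewrite mulrA ler_wpM2r// mulrC -ler_pdivlMr//.
by rewrite ge_min lexx orbT.
Qed.

Lemma is_wderD V (f g : R -> V) t l m :
  is_wder f t l -> is_wder g t m -> is_wder (fun s => f s + g s) t (l + m).
Proof.
move=> fl gm; rewrite /is_wder.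
have -> : wquot (fun s => f s + g s) t = (fun s => wquot f t s + wquot g t s).
  by apply/funext => s; rewrite /wquot -scalerDr opprD addrACA.
exact: cvgD fl gm.
Qed.

Lemma is_wder_cst V (v : V) t : is_wder (fun=> v) t 0.
Proof.
apply/is_wderP => e e0; apply: filterE => s _.
by rewrite subrr scaler0 subrr normr0 mulr_ge0// ltW.
Qed.

Lemma is_wderZ V (f : R -> R^o) (g : R -> V) t l m :
  is_wder f t l -> is_wder g t m ->
  is_wder (fun s => f s *: g s) t (l *: g t + f t *: m).
Proof.
move=> fl gm; have gc := is_wder_continuous gm; rewrite /is_wder.
have -> : wquot (fun s => f s *: g s) t =
    (fun s => wquot f t s *: g s + f t *: wquot g t s).
  apply/funext => s; rewrite /wquot.
  have -> : f t *: ((s - t)^-1 *: (g s - g t)) = (s - t)^-1 *: (f t *: (g s - g t)).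
    by rewrite !scalerA mulrC.
  have -> : ((s - t)^-1 *: (f s - f t)) *: g s = (s - t)^-1 *: ((f s - f t) *: g s).
    by rewrite scalerA.
  by rewrite -scalerDr; congr (_ *: _); rewrite scalerBl scalerBr addrA subrK.
apply: cvgD; last by apply: cvgZ => //; exact: cvg_cst.
apply: cvgZ => // A gA; have H : nbhs t (fun s => I s -> A (g s)) := gc A gA.
have : nbhs t (fun s => s != t -> I s -> A (g s)).
  by apply: filterS H => s H _ Is; exact: H.
by [].
Qed.

Lemma relopen_near J t : relopen J -> J t -> \forall s \near t, I s -> J s.
Proof. by move=> [_]; apply. Qed.

Lemma Ck_rel_eq V J k (f g : R -> V) : relopen J ->
  (forall t, J t -> f t = g t) -> Ck_rel J k f -> Ck_rel J k g.
Proof.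
move=> oJ; elim: k f g => [|k IH] f g fg.
  move=> H t Jt; have nJ := relopen_near oJ Jt.
  have gt : g @ within I (nbhs t) --> f t.
    apply: cvg_trans (H t Jt); apply: near_eq_cvg; rewrite near_withinE.
    by apply: filterS nJ => s JIs /JIs/fg.
  by rewrite (fg _ Jt) in gt.
have H t : J t -> wderivable I f t -> is_wder g t (wderive I f t).
  move=> Jt ft; have nJ := relopen_near oJ Jt.
  apply: is_wder_eq (oJ.1 _ Jt) (wderivableP ft).
  by apply: filterS nJ => s JIs /JIs/fg.
move=> [f1 f2]; split=> [t Jt|]; first exact: is_wder_derivable (H _ Jt (f1 t Jt)).
apply: IH f2 => t Jt; symmetry; apply: is_wderE; first exact: oJ.1.
exact: H (f1 t Jt).
Qed.

Lemma Ck_rel_is_wder V J k (f df : R -> V) : relopen J ->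
  (forall t, J t -> is_wder f t (df t)) -> Ck_rel J k df -> Ck_rel J k.+1 f.
Proof.
move=> oJ H Hdf; split=> [t /H|]; first exact: is_wder_derivable.
apply: (Ck_rel_eq oJ _ Hdf) => t Jt; symmetry.
by apply: is_wderE; [exact: oJ.1|exact: H].
Qed.

Lemma Ck_rel_sub V J J' k (f : R -> V) : J' `<=` J -> Ck_rel J k f -> Ck_rel J' k f.
Proof.
move=> JJ; elim: k f => [|k IH] f; first by move=> H t /JJ; exact: H.
by move=> [H1 H2]; split=> [t /JJ|]; [exact: H1|exact: IH].
Qed.

Lemma Ck_rel_local V J k (f : R -> V) :
  (forall t, J t -> exists2 J', J' t & Ck_rel J' k f) -> Ck_rel J k f.
Proof.
elim: k f => [|k IH] f H; first by move=> t /H[J' J't]; exact.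
split=> [t /H[J' J't []]|]; first by move=> H1 _; exact: H1.
by apply: IH => t /H[J' J't [_ H2]]; exists J'.
Qed.

Lemma Ck_relS V J k (f : R -> V) : Ck_rel J k.+1 f -> Ck_rel J k f.
Proof.
elim: k f => [|k IH] f [H1 H2]; last by split=> //; exact: IH.
by move=> t /H1 ft; exact: is_wder_continuous (wderivableP ft).
Qed.

Lemma Ck_rel_cst V J k (v : V) : relopen J -> Ck_rel J k (fun=> v).
Proof.
move=> oJ; elim: k v => [|k IH] v; first by move=> t _; exact: cvg_cst.
apply: (Ck_rel_is_wder (df := fun=> 0)) => // t _; exact: is_wder_cst.
Qed.

Lemma Ck_relD V J k (f g : R -> V) : relopen J ->
  Ck_rel J k f -> Ck_rel J k g -> Ck_rel J k (fun t => f t + g t).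
Proof.
move=> oJ; elim: k f g => [|k IH] f g.
  by move=> fc gc t Jt; exact: (cvgD (fc t Jt) (gc t Jt)).
move=> [f1 f2] [g1 g2].
apply: (Ck_rel_is_wder (df := fun t => wderive I f t + wderive I g t)) => //.
  by move=> t Jt; exact: (is_wderD (wderivableP (f1 _ Jt)) (wderivableP (g1 _ Jt))).
exact: (IH _ _ f2 g2).
Qed.

Lemma Ck_relZ V J k (f : R -> R^o) (g : R -> V) : relopen J ->
  Ck_rel J k f -> Ck_rel J k g -> Ck_rel J k (fun t => f t *: g t).
Proof.
move=> oJ; elim: k f g => [|k IH] f g.
  by move=> fc gc t Jt; exact: (cvgZ (fc t Jt) (gc t Jt)).
move=> Sf Sg; have [f1 f2] := Sf; have [g1 g2] := Sg.
apply: (Ck_rel_is_wder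
  (df := fun t => wderive I f t *: g t + f t *: wderive I g t)) => //.
  by move=> t Jt; exact: (is_wderZ (wderivableP (f1 _ Jt)) (wderivableP (g1 _ Jt))).
apply: (Ck_relD oJ).
  exact: (IH _ _ f2 (Ck_relS Sg)).
exact: (IH _ _ (Ck_relS Sf) g2).
Qed.

Lemma Ck_rel_sum V J k (T : Type) (r : seq T) (P : pred T) (f : T -> R -> V) :
  relopen J -> (forall i, Ck_rel J k (f i)) ->
  Ck_rel J k (fun t => \sum_(i <- r | P i) f i t).
Proof.
move=> oJ H; rewrite -fct_sumE; elim/big_ind : _ => [|a b|//].
  exact: Ck_rel_cst.
exact: Ck_relD.
Qed.

Lemma is_wder_coord n (f : R -> 'rV[R]_n) t l j :
  is_wder f t l -> is_wder (fun s => f s 0 j : R^o) t (l 0 j).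
Proof.
move=> fl; have id_diff : is_diff (f t) (fun v : 'rV[R]_n => v) id.
  exact: is_diff_id.
exact: (is_wder_comp fl (is_diff_coord j id_diff)).
Qed.

Lemma Ck_rel_coord n J k (f : R -> 'rV[R]_n) j : relopen J ->
  Ck_rel J k f -> Ck_rel J k (fun t => f t 0 j : R^o).
Proof.
move=> oJ; elim: k f => [|k IH] f.
  move=> fc t Jt; have := @coord_continuous _ 1 n 0 j (f t).
  by apply: cvg_comp; exact: fc.
move=> [f1 f2].
apply: (Ck_rel_is_wder (df := fun t => wderive I f t 0 j : R^o)) => //.
  by move=> t Jt; apply: is_wder_coord; exact: wderivableP (f1 _ Jt).
exact: (IH _ f2).
Qed.

Lemma Ck_rel_comp W n J (U : set 'rV[R]_n) k (f : 'rV[R]_n -> W)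
    (c : R -> 'rV[R]_n) : relopen J -> open U -> (forall t, J t -> U (c t)) ->
  Ck_on U k f -> Ck_rel J k c -> Ck_rel J k (f \o c).
Proof.
move=> oJ oU cU; elim: k f c cU => [|k IH] f c cU.
  by move=> fc cc t Jt; apply: cvg_comp (cc t Jt) (fc _ (cU t Jt)).
move=> [f1 f2] Sc; have [c1 c2] := Sc.
apply: (Ck_rel_is_wder (df := fun t =>
    \sum_j (wderive I c t 0 j : R^o) *: 'd f (c t) (delta_mx 0 j))) => //.
  move=> t Jt; rewrite -diff_row_sum.
  exact: (is_wder_comp (wderivableP (c1 _ Jt)) (differentiableP (f1 _ (cU _ Jt)))).
apply: (Ck_rel_sum (f := fun j t =>
    (wderive I c t 0 j : R^o) *: 'd f (c t) (delta_mx 0 j)) _ _ oJ) => j.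
apply: (Ck_relZ (f := fun t => wderive I c t 0 j : R^o)
  (g := (fun y => 'd f y (delta_mx 0 j)) \o c) oJ).
  exact: (Ck_rel_coord j oJ c2).
exact: (IH (fun y => 'd f y (delta_mx 0 j)) c cU (f2 _) (Ck_relS Sc)).
Qed.

Lemma within_relopen J t : relopen J -> J t -> within J (nbhs t) = within I (nbhs t).
Proof.
move=> oJ Jt; have nJ := relopen_near oJ Jt.
apply/seteqP; split=> A; rewrite /within /=; apply: filterS2 nJ => s.
  by move=> JIs JA Is; exact/JA/JIs.
by move=> _ IA /oJ.1; exact: IA.
Qed.

Lemma dwithin_relopen J t : relopen J -> J t -> within J t^' = within I t^'.
Proof.
move=> oJ Jt; have nJ := relopen_near oJ Jt.
apply/seteqP; split=> A; rewrite /within /= /dnbhs /within /=;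
  apply: filterS2 nJ => s.
  by move=> JIs JA st Is; exact: JA st (JIs Is).
by move=> _ IA st /oJ.1; exact: IA.
Qed.

(** Near a point of a relatively open J, the neighbourhoods within J and within I generate the same
    filters, so all iterated derivatives agree on J. *)
Lemma Ck_withinP V J k (f : R -> V) : relopen J ->
  Ck_within J k f <-> Ck_rel J k f.
Proof.
move=> oJ; elim: k f => [|k IH] f.
  split=> [/subspace_continuousP H t Jt|H].
    by rewrite -(within_relopen oJ Jt); exact: H.
  by apply/subspace_continuousP => t Jt; rewrite (within_relopen oJ Jt); exact: H.
have E t : J t -> wderive J f t = wderive I f t.
  by move=> Jt; rewrite /wderive dwithin_relopen.
split=> [[H1 H2]|[H1 H2]]; split.
- by move=> t Jt; have := H1 t Jt; rewrite /wderivable (dwithin_relopen oJ Jt).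
- by apply: (Ck_rel_eq oJ E _); exact/IH.
- by move=> t Jt; rewrite /wderivable (dwithin_relopen oJ Jt); exact: H1.
- by apply/IH; apply: (Ck_rel_eq oJ _ H2) => t Jt; rewrite E.
Qed.

Lemma relopenI J J' : relopen J -> relopen J' -> relopen (J `&` J').
Proof.
move=> [JI nJ] [_ nJ']; split=> [t [/JI]//|t [/nJ+ /nJ']].
by apply: filterS2 => s H1 H2 Is; split; [exact: H1|exact: H2].
Qed.

Lemma relopenT : relopen I.
Proof. by split=> // t _; exact: filterE. Qed.

Lemma relopen_preimage (T : topologicalType) (g : R -> T) (U : set T) :
  {within I, continuous g} -> open U -> relopen (I `&` g @^-1` U).
Proof.
move=> /subspace_continuousP gc oU; split=> [t []//|t [It Ugt]].
have H : nbhs t (fun s => I s -> U (g s)) :=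
  gc t It _ (open_nbhs_nbhs (conj oU Ugt)).
by apply: filterS H => s H Is; split=> //; exact: H.
Qed.

End Curves.

(** This makes derivatives within [a, b] unique. The point t is approached from the right if t < b,
    and from the left if t = b. *)
Lemma limit_point_itvcc (R : realType) (a b t : R) : a < b ->
  `[a, b]%classic t -> ProperFilter (within `[a, b] t^').
Proof.
move=> ab /=; rewrite in_itv /= => /andP[at_ tb].
apply: Build_ProperFilter_ex => A; rewrite /within /= => HA.
have {}HA : nbhs t (fun s => s != t -> `[a, b]%classic s -> A s) := HA.
have [tb'|bt] := ltP t b.
  have HA' : \forall s \near t^'+, s != t -> `[a, b]%classic s -> A s.
    by rewrite near_withinE; apply: filterS HA => s Hs _.
  near t^'+ => s; exists s.
  have ts : t < s by near: s; exact: nbhs_right_gt.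
  have sb : s < b by near: s; exact: nbhs_right_lt.
  have : s != t -> `[a, b]%classic s -> A s by near: s.
  apply; first by rewrite gt_eqF.
  by rewrite /= in_itv /= (le_trans at_ (ltW ts)) /= ltW.
have HA' : \forall s \near t^'-, s != t -> `[a, b]%classic s -> A s.
  by rewrite near_withinE; apply: filterS HA => s Hs _.
near t^'- => s; exists s.
have ts : s < t by near: s; exact: nbhs_left_lt.
have as_ : a < s by near: s; apply: nbhs_left_gt; exact: lt_le_trans ab bt.
have : s != t -> `[a, b]%classic s -> A s by near: s.
apply; first by rewrite lt_eqF.
by rewrite /= in_itv /= (le_trans (ltW ts) tb) andbT ltW.
Unshelve. all: by end_near.
Qed.

(** * Differentials in charts *)

Section Charts.
Context {R : realType} {n : nat}.
Implicit Types M N P : manifoldType R n.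

Lemma within_open_continuous (S T : topologicalType) (f : S -> T) (A : set S) x :
  open A -> {within A, continuous f} -> A x -> {for x, continuous f}.
Proof.
move=> oA /subspace_continuousP fc Ax B fB.
have H : nbhs x (fun y => A y -> B (f y)) := fc x Ax B fB.
by apply: filterS2 (open_nbhs_nbhs (conj oA Ax)) H => y Ay; exact.
Qed.

Section OneChart.
Context {M : manifoldType R n} (c : chart R n M).

Lemma cinvK p : cdom c p -> cinv c (cmap c p) = p.
Proof. by move=> cp; apply: (@cmapK _ _ _ c); exact: mem_set. Qed.

Lemma cimg_cmap p : cdom c p -> cimg c (cmap c p).
Proof. by move=> cp; exists p. Qed.

Lemma cdom_cinv x : cimg c x -> cdom c (cinv c x).
Proof. by move=> [p cp <-]; rewrite cinvK. Qed.

Lemma cmap_cinv x : cimg c x -> cmap c (cinv c x) = x.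
Proof. by move=> [p cp <-]; rewrite cinvK. Qed.

Lemma cinv_cont x : cimg c x -> {for x, continuous (cinv c)}.
Proof.
move=> cx.
exact: (within_open_continuous (@cimg_open _ _ _ c) (@cinv_continuous _ _ _ c) cx).
Qed.

Lemma nbhs_cimg x : cimg c x -> nbhs x (cimg c).
Proof.
by move=> cx; apply: open_nbhs_nbhs; split; [exact: (@cimg_open _ _ _ c)|].
Qed.

Lemma nbhs_cdom p : cdom c p -> nbhs p (cdom c).
Proof.
by move=> cp; apply: open_nbhs_nbhs; split; [exact: (@cdom_open _ _ _ c)|].
Qed.

Lemma cmap_imageE (U : set M) :
  cmap c @` (cdom c `&` U) = cimg c `&` cinv c @^-1` U.
Proof.
apply/seteqP; split=> [x [p [cp Up] <-]|x [cx Ux]].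
  by split; [exact: cimg_cmap|rewrite /= cinvK].
exists (cinv c x); last exact: cmap_cinv.
by split=> //; exact: cdom_cinv.
Qed.

Lemma open_cmap_image (U : set M) : open U -> open (cmap c @` (cdom c `&` U)).
Proof.
move=> oU; rewrite cmap_imageE openE => x [cx Ux]; apply: filterI.
  exact: nbhs_cimg.
exact: (cinv_cont cx (open_nbhs_nbhs (conj oU Ux))).
Qed.

Lemma near_cinv p (A : set M) : cdom c p -> nbhs p A ->
  \forall x \near cmap c p, cimg c x /\ A (cinv c x).
Proof.
move=> cp pA; apply: filterI.
  exact: nbhs_cimg (cimg_cmap cp).
by apply: (cinv_cont (cimg_cmap cp)); rewrite cinvK.
Qed.

End OneChart.

Lemma chart_at_atlas M (p : M) : atlas (chart_at p).
Proof. by rewrite /chart_at; case: cid2. Qed.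

Lemma chart_at_dom M (p : M) : cdom (chart_at p) p.
Proof. by rewrite /chart_at; case: cid2. Qed.

Definition mdifferentiable M N (F : M -> N) (p : M) :=
  {for p, continuous F} /\
  forall (c : chart R n M) (d : chart R n N), atlas c -> atlas d ->
    cdom c p -> cdom d (F p) ->
    differentiable (cmap d \o F \o cinv c) (cmap c p).

Definition fdifferentiable M (f : M -> R) (p : M) :=
  forall c : chart R n M, atlas c -> cdom c p ->
    differentiable (f \o cinv c : _ -> R^o) (cmap c p).

Lemma smooth_map_mdifferentiable M N (F : M -> N) p :
  smooth_map F -> mdifferentiable F p.
Proof.
move=> [Fc Fs]; split=> [|c d ac ad cp dp]; first exact: Fc.
by have [H _] := Fs c d ac ad 1; apply: H; exists p.
Qed.

Lemma mdifferentiable_id M (p : M) : mdifferentiable id p.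
Proof.
split=> [|c d ac ad cp dp]; first exact: cvg_id.
by have [H _] := atlas_smooth _ _ ac ad 1; apply: H; exists p.
Qed.

Lemma smooth_fun_on_fdifferentiable M (U : set M) (f : M -> R) p :
  smooth_fun_on U f -> U p -> fdifferentiable f p.
Proof.
move=> fs Up c ac cp; have [H _] := fs c ac 1.
by apply: H; exists p.
Qed.

(** The chain rule through an intermediate chart d. The formula for the composite holds only near
    the point, where F stays in the domain of d. With F = id it is the change of charts. *)
Lemma is_diff_chart_comp M N (W : normedModType R) (f : N -> W) (F : M -> N)
    (c : chart R n M) (d : chart R n N) p df dF :
  cdom c p -> cdom d (F p) -> {for p, continuous F} ->
  is_diff (cmap d (F p)) (f \o cinv d) df ->
  is_diff (cmap c p) (cmap d \o F \o cinv c) dF ->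
  is_diff (cmap c p) (f \o F \o cinv c) (df \o dF).
Proof.
move=> cp dFp Fc fd Fd.
have E : (cmap d \o F \o cinv c) (cmap c p) = cmap d (F p) by rewrite /= cinvK.
have fd' : is_diff ((cmap d \o F \o cinv c) (cmap c p)) (f \o cinv d) df.
  by rewrite E.
apply: near_eq_is_diff (is_diff_comp Fd fd').
have dF' : nbhs p (F @^-1` cdom d).
  by apply: Fc; exact: nbhs_cdom.
apply: filterS (near_cinv cp dF') => x [cx dx] /=.
by rewrite cinvK.
Qed.

Lemma is_diff_chart M N (F : M -> N) p (c : chart R n M) (d : chart R n N) :
  mdifferentiable F p -> atlas c -> atlas d -> cdom c p -> cdom d (F p) ->
  is_diff (cmap c p) (cmap d \o F \o cinv c)
    ('d (cmap d \o F \o cinv c) (cmap c p)).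
Proof. by move=> [_ H] *; apply: differentiableP; exact: H. Qed.

Lemma tcoord_chart M (c d : chart R n M) p (v : 'rV[R]_n) :
  atlas c -> atlas d -> cdom c p -> cdom d p ->
  @tcoord _ _ _ d p v = 'd (cmap d \o cinv c) (cmap c p) (@tcoord _ _ _ c p v).
Proof.
move=> ac ad cp dp; have ap := chart_at_atlas p; have pp := chart_at_dom p.
have Ip := mdifferentiable_id p.
exact: (is_diffE v (is_diff_chart_comp (F := id) pp cp Ip.1
  (is_diff_chart Ip ac ad cp dp) (is_diff_chart Ip ap ac pp cp))).
Qed.

Lemma tcoord_id M p (v : 'rV[R]_n) : @tcoord _ _ M (chart_at p) p v = v.
Proof.
have pp := chart_at_dom p; rewrite /tcoord.
suff H : is_diff (cmap (chart_at p) p)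
    (cmap (chart_at p) \o cinv (chart_at p)) id by exact: (is_diffE v H).
apply: near_eq_is_diff (is_diff_id _).
by apply: filterS (near_cinv pp filterT) => x [cx _] /=; rewrite cmap_cinv.
Qed.

Lemma tcoordD M (c : chart R n M) (p : M) (u v : 'rV[R]_n) :
  @tcoord _ _ _ c p (u + v) = @tcoord _ _ _ c p u + @tcoord _ _ _ c p v.
Proof. by rewrite /tcoord linearD. Qed.

Lemma tcoordZ M (c : chart R n M) (p : M) k (u : 'rV[R]_n) :
  @tcoord _ _ _ c p (k *: u) = k *: @tcoord _ _ _ c p u.
Proof. by rewrite /tcoord linearZ. Qed.

(** The map F read from [chart_at p] to d is differentiated twice, once through [chart_at (F p)] and
    once through c. *)
Lemma mdiffE M N (F : M -> N) p (c : chart R n M) (d : chart R n N)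
    (v : 'rV[R]_n) :
  mdifferentiable F p -> atlas c -> atlas d -> cdom c p -> cdom d (F p) ->
  @tcoord _ _ _ d (F p) (@mdiff _ _ _ _ F p v) =
  'd (cmap d \o F \o cinv c) (cmap c p) (@tcoord _ _ _ c p v).
Proof.
move=> Fp ac ad cp dFp; have ap := chart_at_atlas p; have pp := chart_at_dom p.
have aF := chart_at_atlas (F p); have FF := chart_at_dom (F p).
have Ip := mdifferentiable_id p; have IF := mdifferentiable_id (F p).
have H1 := is_diffE v (is_diff_chart_comp (F := F) pp FF Fp.1
  (is_diff_chart IF aF ad FF dFp) (is_diff_chart Fp ap aF pp FF)).
have H2 := is_diffE v (is_diff_chart_comp (F := id) pp cp Ip.1
  (is_diff_chart Fp ac ad cp dFp) (is_diff_chart Ip ap ac pp cp)).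
exact: etrans (esym H1) H2.
Qed.

Lemma mdiff_comp M N P (G : N -> P) (F : M -> N) p (v : 'rV[R]_n) :
  mdifferentiable F p -> mdifferentiable G (F p) ->
  @mdiff _ _ _ _ (G \o F) p v = @mdiff _ _ _ _ G (F p) (@mdiff _ _ _ _ F p v).
Proof.
move=> Fp Gp.
exact: (is_diffE v (is_diff_chart_comp (chart_at_dom p) (chart_at_dom (F p)) Fp.1
  (is_diff_chart Gp (chart_at_atlas _) (chart_at_atlas _)
    (chart_at_dom _) (chart_at_dom _))
  (is_diff_chart Fp (chart_at_atlas _) (chart_at_atlas _)
    (chart_at_dom _) (chart_at_dom _)))).
Qed.

Lemma mdiff_id M p (v : 'rV[R]_n) : @mdiff _ _ M M id p v = v.
Proof. exact: tcoord_id. Qed.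

Lemma mdiffD M N (F : M -> N) p (u v : 'rV[R]_n) :
  @mdiff _ _ _ _ F p (u + v) = @mdiff _ _ _ _ F p u + @mdiff _ _ _ _ F p v.
Proof. by rewrite /mdiff linearD. Qed.

Lemma mdiffZ M N (F : M -> N) p k (u : 'rV[R]_n) :
  @mdiff _ _ _ _ F p (k *: u) = k *: @mdiff _ _ _ _ F p u.
Proof. by rewrite /mdiff linearZ. Qed.

Lemma fdiffE M (f : M -> R) p (c : chart R n M) (v : 'rV[R]_n) :
  fdifferentiable f p -> atlas c -> cdom c p ->
  @fdiff _ _ _ f p v = 'd (f \o cinv c : _ -> R^o) (cmap c p) (@tcoord _ _ _ c p v).
Proof.
move=> fp ac cp; have Ip := mdifferentiable_id p.
exact: (is_diffE v (is_diff_chart_comp (F := id) (chart_at_dom p) cp Ip.1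
  (differentiableP (fp c ac cp))
  (is_diff_chart Ip (chart_at_atlas _) ac (chart_at_dom _) cp))).
Qed.

Lemma fdiff_comp M N (f : N -> R) (F : M -> N) p (v : 'rV[R]_n) :
  mdifferentiable F p -> fdifferentiable f (F p) ->
  @fdiff _ _ _ (f \o F) p v = @fdiff _ _ _ f (F p) (@mdiff _ _ _ _ F p v).
Proof.
move=> Fp fp.
exact: (is_diffE v (is_diff_chart_comp (chart_at_dom p) (chart_at_dom (F p)) Fp.1
  (differentiableP (fp _ (chart_at_atlas _) (chart_at_dom _)))
  (is_diff_chart Fp (chart_at_atlas _) (chart_at_atlas _)
    (chart_at_dom _) (chart_at_dom _)))).
Qed.

Lemma fdiff_cst M (k : R) p (v : 'rV[R]_n) : @fdiff _ _ M (fun=> k) p v = 0.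
Proof. exact: (is_diffE v (is_diff_cst (k : R^o) _)). Qed.

End Charts.

(** * Left translations *)

Section Translations.
Context {R : realType} {n : nat} {G : lieGroupType R n}.
Local Notation e := (1%g : G).
Implicit Types (x y p q : G) (xi eta zeta : 'rV[R]_n).

Definition mul_rep (b c d : chart R n G) (z : 'rV[R]_n * 'rV[R]_n) : 'rV[R]_n :=
  cmap d (cinv b z.1 * cinv c z.2)%g.

Definition mul_dom (b c d : chart R n G) : set ('rV[R]_n * 'rV[R]_n) :=
  (cimg b `*` cimg c) `&` [set z | cdom d (cinv b z.1 * cinv c z.2)%g].

Lemma mul_rep_smooth b c d : atlas b -> atlas c -> atlas d ->
  smooth_on (mul_dom b c d) (mul_rep b c d).
Proof. by move=> ab ac ad; have [_ H] := @lie_mul_smooth R n G; exact: H. Qed.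

Lemma mul_cont : continuous (fun z : G * G => (z.1 * z.2)%g).
Proof. by have [] := @lie_mul_smooth R n G. Qed.

Lemma mul_dom_open b c d : open (mul_dom b c d).
Proof.
rewrite openE => z [[bz cz] dz].
have nb : \forall w \near z, cimg b w.1 by exact: (cvg_fst (nbhs_cimg bz)).
have nc : \forall w \near z, cimg c w.2 by exact: (cvg_snd (nbhs_cimg cz)).
have Hb : (fun w : 'rV[R]_n * 'rV[R]_n => cinv b w.1) @ z --> cinv b z.1.
  apply: (cvg_comp (fun w : 'rV[R]_n * 'rV[R]_n => w.1) (cinv b)); last first.
    exact: (cinv_cont bz).
  exact: cvg_fst.
have Hc : (fun w : 'rV[R]_n * 'rV[R]_n => cinv c w.2) @ z --> cinv c z.2.
  apply: (cvg_comp (fun w : 'rV[R]_n * 'rV[R]_n => w.2) (cinv c)); last first.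
    exact: (cinv_cont cz).
  exact: cvg_snd.
have H : (fun w : 'rV[R]_n * 'rV[R]_n => (cinv b w.1 * cinv c w.2)%g) @ z -->
    (cinv b z.1 * cinv c z.2)%g.
  exact: (cvg_comp _ _ (cvg_pair Hb Hc) (@mul_cont (cinv b z.1, cinv c z.2))).
have nd := H _ (nbhs_cdom dz).
by apply: filterI => //; apply: filterI.
Qed.

Lemma is_diff_pairl (u v : 'rV[R]_n) :
  is_diff v (fun y : 'rV[R]_n => (u, y)) (fun h => (0, h)).
Proof. exact: (is_diff_pair (is_diff_cst u v) (is_diff_id v)). Qed.

Lemma is_diff_pairr (u v : 'rV[R]_n) :
  is_diff v (fun y : 'rV[R]_n => (y, u)) (fun h => (h, 0)).
Proof. exact: (is_diff_pair (is_diff_id v) (is_diff_cst u v)). Qed.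

Lemma Lmul_cont x : continuous (Lmul x).
Proof.
move=> p.
exact: (cvg_comp _ _ (cvg_pair (@cvg_cst _ x _ (nbhs p) _) (@cvg_id _ (nbhs p)))
    (@mul_cont (x, p))).
Qed.

Lemma Lmul_smooth x : smooth_map (Lmul x).
Proof.
split=> [p|c d ac ad k].
  exact: Lmul_cont.
have ax := chart_at_atlas x; have xx := chart_at_dom x.
pose A (y : 'rV[R]_n) := (cmap (chart_at x) x, y).
have dom : A @^-1` mul_dom (chart_at x) c d =
    cmap c @` (cdom c `&` Lmul x @^-1` cdom d).
  rewrite cmap_imageE; apply/seteqP; split=> y; rewrite /mul_dom /A /= cinvK//.
    by move=> [[_ cy] dy].
  by move=> [cy dy]; split=> //; split=> //; exact: cimg_cmap.
have -> : cmap d \o Lmul x \o cinv c = mul_rep (chart_at x) c d \o A.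
  by apply/funext => y; rewrite /mul_rep /A /= cinvK.
rewrite -dom; apply: (Ck_on_comp_affine _ _ (is_diff_pairl _)).
- exact: mul_dom_open.
- rewrite dom; apply: open_cmap_image.
  rewrite openE => y xy.
  exact: (@Lmul_cont x y _ (nbhs_cdom xy)).
- exact: mul_rep_smooth.
Qed.

Lemma Lmul_mdiff x p : mdifferentiable (Lmul x) p.
Proof. exact: smooth_map_mdifferentiable (Lmul_smooth x). Qed.

(** Stated on the model space, so that group laws can be rewritten in the base point without
    transporting the vector. *)
Definition dL x p (v : 'rV[R]_n) : 'rV[R]_n := @mdiff R n G G (Lmul x) p v.

Lemma dLM x y p v : dL x (y * p)%g (dL y p v) = dL (x * y)%g p v.
Proof.
rewrite /dL; have -> : Lmul (x * y)%g = Lmul x \o Lmul y.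
  by apply/funext => q; rewrite /Lmul /= mulgA.
by rewrite (mdiff_comp _ (Lmul_mdiff y p) (Lmul_mdiff x (Lmul y p))).
Qed.

Lemma dL1 p v : dL 1%g p v = v.
Proof.
rewrite /dL; have -> : Lmul (1%g : G) = id by apply/funext => q; exact: mul1g.
exact: mdiff_id.
Qed.

Lemma dLVK x p v : dL x (x^-1 * p)%g (dL x^-1%g p v) = v.
Proof. by rewrite dLM mulgV dL1. Qed.

Lemma dLD x p u v : dL x p (u + v) = dL x p u + dL x p v.
Proof. exact: mdiffD. Qed.

Lemma dLZ x p k v : dL x p (k *: v) = k *: dL x p v.
Proof. exact: mdiffZ. Qed.

Lemma dL0 x p : dL x p 0 = 0.
Proof. by have := dLZ x p 0 0; rewrite !scale0r. Qed.

Lemma phiE xi p : phi xi p = dL p e xi. Proof. by []. Qed.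

Lemma dL_phi x p xi : dL x p (phi xi p) = phi xi (x * p)%g.
Proof. by have := dLM x p e xi; rewrite mulg1. Qed.

(** The Maurer-Cartan form at p, inverse to xi |-> phi xi p. *)
Definition left_coord p (v : 'rV[R]_n) : 'rV[R]_n := dL p^-1%g p v.

Lemma phi_left_coord p v : phi (left_coord p v) p = v.
Proof. by rewrite phiE /left_coord -[RHS](dLVK p p v) mulVg. Qed.

Lemma left_coord_phi p xi : left_coord p (phi xi p) = xi.
Proof. by rewrite /left_coord dL_phi mulVg phiE dL1. Qed.

Lemma phiD xi eta p : phi (xi + eta) p = phi xi p + phi eta p.
Proof. exact: dLD. Qed.

Lemma phiZ k xi p : phi (k *: xi) p = k *: phi xi p.
Proof. exact: dLZ. Qed.

Lemma left_coordD p u v : left_coord p (u + v) = left_coord p u + left_coord p v.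
Proof. exact: dLD. Qed.

Lemma left_coordZ p k u : left_coord p (k *: u) = k *: left_coord p u.
Proof. exact: dLZ. Qed.

Lemma left_coord_dL x p v : left_coord (x * p)%g (dL x p v) = left_coord p v.
Proof. by rewrite /left_coord dLM invgM mulgVK. Qed.

Lemma phi_sum xi p : phi xi p = \sum_j xi 0 j *: phi (delta_mx 0 j) p.
Proof.
pose f := (fun v : 'rV[R]_n => phi v p : 'rV[R]_n).
have fD : {morph f : u v / u + v >-> u + v} by move=> u v; exact: phiD.
have f0 : f 0 = 0 by rewrite -(scale0r (0 : 'rV[R]_n)) [LHS]phiZ !scale0r.
rewrite {1}[xi]row_sum_delta -[LHS]/(f _) (big_morph f fD f0).
by apply: eq_bigr => j _; exact: phiZ.
Qed.

(** This displays the field as a partial differential of the multiplication at a fixed second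
    factor, so that its dependence on x is visibly smooth. *)
Lemma vf_coord_phi (c : chart R n G) (x : 'rV[R]_n) xi : atlas c -> cimg c x ->
  vf_coord c (phi xi) x =
  'd (mul_rep c (chart_at e) c) (x, cmap (chart_at e) e) (0, xi).
Proof.
move=> ac cx; have ae := chart_at_atlas e; have ee := chart_at_dom e.
have dom : mul_dom c (chart_at e) c (x, cmap (chart_at e) e).
  split; first by split=> //=; exact: cimg_cmap.
  by rewrite /= cinvK// mulg1; exact: cdom_cinv.
have [Hd _] := mul_rep_smooth ac ae ac 1.
have /differentiableP Dx := Hd _ dom.
have D := is_diff_comp (is_diff_pairl x (cmap (chart_at e) e)) Dx.
have cp : cdom c (Lmul (cinv c x) e) by rewrite /Lmul mulg1; exact: cdom_cinv.
have E1 : vf_coord c (phi xi) x =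
    @tcoord _ _ _ c (Lmul (cinv c x) e) (phi xi (cinv c x)).
  by have -> : Lmul (cinv c x) e = cinv c x by exact: mulg1.
rewrite E1 (mdiffE xi (Lmul_mdiff _ _) ae ac ee cp) tcoord_id.
exact: (is_diffE xi D).
Qed.

Lemma phi_smooth xi : smooth_vfield (phi xi : vfield G).
Proof.
move=> c ac k; rewrite cmap_imageE preimage_setT setIT.
have ae := chart_at_atlas e; have ee := chart_at_dom e.
(* One order of differentiability is spent on the direction (0, xi). *)
have [_ H] := mul_rep_smooth ac ae ac k.+1.
have dom : (fun x : 'rV[R]_n => (x, cmap (chart_at e) e)) @^-1`
    mul_dom c (chart_at e) c = cimg c.
  apply/seteqP; split=> [x [[]]//|x cx]; split; first by split=> //=; exact: cimg_cmap.
  by rewrite /= cinvK// mulg1; exact: cdom_cinv.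
have oc : open (cimg c) := @cimg_open _ _ _ c.
have K : Ck_on (cimg c) k (fun x : 'rV[R]_n => 'd (mul_rep c (chart_at e) c)
    (x, cmap (chart_at e) e) (0, xi)).
  rewrite -dom; apply: (Ck_on_comp_affine _ _ (is_diff_pairr _) (H (0, xi))).
    exact: mul_dom_open.
  by rewrite dom.
by apply: Ck_on_eq oc _ K => x cx; rewrite vf_coord_phi.
Qed.

End Translations.

(** * Smooth vector fields and their brackets *)

Section SmoothFields.
Context {R : realType} {n : nat}.
Implicit Types M N : manifoldType R n.

Lemma vf_coord_cmap M (c : chart R n M) (X : vfield M) p : cdom c p ->
  vf_coord c X (cmap c p) = tcoord c (X p).
Proof. by move=> cp; rewrite /vf_coord cinvK. Qed.

Lemma vf_coord_diff M (c : chart R n M) (X : vfield M) p :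
  smooth_vfield X -> atlas c -> cdom c p ->
  differentiable (vf_coord c X) (cmap c p).
Proof. by move=> Xs ac cp; have [H _] := Xs c ac 1; apply: H; exists p. Qed.

Lemma smooth_fun_cst M (k : R) : smooth_fun (fun _ : M => k).
Proof. by move=> c ac j; exact: (Ck_on_cst _ _ (k : R^o)). Qed.

Lemma smooth_vfieldD M (X Y : vfield M) : smooth_vfield X -> smooth_vfield Y ->
  smooth_vfield (fun p => X p + Y p : 'rV[R]_n).
Proof.
move=> Xs Ys c ac k.
have -> : vf_coord c (fun p => X p + Y p : 'rV[R]_n) =
    (fun x => vf_coord c X x + vf_coord c Y x).
  by apply/funext => x; rewrite /vf_coord tcoordD.
by apply: Ck_onD; [exact/open_cmap_image/openT|exact: Xs|exact: Ys].
Qed.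

Lemma smooth_vfieldZ M (f : M -> R) (X : vfield M) : smooth_fun f ->
  smooth_vfield X -> smooth_vfield (fun p => f p *: X p : 'rV[R]_n).
Proof.
move=> fs Xs c ac k.
have -> : vf_coord c (fun p => f p *: X p : 'rV[R]_n) =
    (fun x => ((f \o cinv c) x : R^o) *: vf_coord c X x).
  by apply/funext => x; rewrite /vf_coord tcoordZ.
by apply: Ck_onZ; [exact/open_cmap_image/openT|exact: fs|exact: Xs].
Qed.

Lemma smooth_funD M (U : set M) (f g : M -> R) : open U -> smooth_fun_on U f ->
  smooth_fun_on U g -> smooth_fun_on U (fun p => f p + g p).
Proof.
move=> oU fs gs c ac k; have oc := @open_cmap_image _ _ _ c _ oU.
exact: (Ck_onD oc (fs c ac k) (gs c ac k)).
Qed.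

Lemma smooth_funM M (U : set M) (f g : M -> R) : open U -> smooth_fun_on U f ->
  smooth_fun_on U g -> smooth_fun_on U (fun p => f p * g p).
Proof.
move=> oU fs gs c ac k; have oc := @open_cmap_image _ _ _ c _ oU.
exact: (Ck_onZ oc (fs c ac k) (gs c ac k)).
Qed.

Lemma smooth_fun_sum M (U : set M) (I : Type) (r : seq I) (P : pred I)
    (f : I -> M -> R) : open U -> (forall i, smooth_fun_on U (f i)) ->
  smooth_fun_on U (fun p => \sum_(i <- r | P i) f i p).
Proof.
move=> oU fs; rewrite -fct_sumE; elim/big_ind : _ => [|a b|//].
  by move=> c ac j; exact: (Ck_on_cst _ _ (0 : R^o)).
exact: smooth_funD.
Qed.

Lemma fdiff_vf_coord M (f : M -> R) (X : vfield M) (c : chart R n M) x :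
  smooth_fun f -> atlas c -> cimg c x ->
  fdiff f (X (cinv c x)) = 'd (f \o cinv c : _ -> R^o) x (vf_coord c X x).
Proof.
move=> fs ac cx; have fp := smooth_fun_on_fdifferentiable fs (I : setT (cinv c x)).
by rewrite (fdiffE _ fp ac (cdom_cinv cx)) cmap_cinv.
Qed.

Lemma smooth_fun_fdiff M (f : M -> R) (X : vfield M) : smooth_fun f ->
  smooth_vfield X -> smooth_fun (fun p => fdiff f (X p)).
Proof.
move=> fs Xs c ac k; have oc := @open_cmap_image _ _ _ c _ (@openT M).
have [_ f2] := fs c ac k.+1; have Xk := Xs c ac k.
have K : Ck_on (cmap c @` (cdom c `&` setT)) k (fun x => \sum_j
    (vf_coord c X x 0 j : R^o) *: 'd (f \o cinv c : _ -> R^o) x (delta_mx 0 j)).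
  apply: (Ck_on_sum _ _ oc) => j; apply: (Ck_onZ oc); last exact: f2.
  exact: (Ck_on_coord j oc Xk).
apply: (Ck_on_eq oc _ K) => x; rewrite cmap_imageE => -[cx _].
by rewrite [RHS]fdiff_vf_coord// [RHS]diff_row_sum.
Qed.

(** Used for the tensoriality of the curvature in its last argument, where the derivative along
    [X, Y] has to absorb the second derivatives of f. *)
Lemma fdiff_bracket M (f : M -> R) (X Y : vfield M) p : smooth_fun f ->
  smooth_vfield X -> smooth_vfield Y ->
  fdiff f (vf_bracket X Y p) =
  fdiff (fun q => fdiff f (Y q)) (X p) - fdiff (fun q => fdiff f (X q)) (Y p).
Proof.
move=> fs Xs Ys; have ac := chart_at_atlas p; have cp := chart_at_dom p.
pose c := chart_at p; have oc := @open_cmap_image _ _ _ c _ (@openT M).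
have fk := fs c ac; pose phi := (f \o cinv c : _ -> R^o).
have Ux : (cmap c @` (cdom c `&` setT)) (cmap c p) by exists p.
have nU : \forall x \near cmap c p, cimg c x by exact: nbhs_cimg (cimg_cmap cp).
have [f1 f2] := fk 2.
have sym u v : 'd (fun y => 'd phi y u : R^o) (cmap c p) v =
    'd (fun y => 'd phi y v : R^o) (cmap c p) u.
  apply: diff_diff_sym; last 2 first.
  - by have [H _] := f2 u; exact: H.
  - by have [H _] := f2 v; exact: H.
  have := open_nbhs_nbhs (conj oc Ux); apply: filterS => x; exact: f1.
have Xp : vf_coord c X (cmap c p) = X p by rewrite vf_coord_cmap// tcoord_id.
have Yp : vf_coord c Y (cmap c p) = Y p by rewrite vf_coord_cmap// tcoord_id.
have B := diff_bracket oc Ux (fk 2) sym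
  (vf_coord_diff Xs ac cp) (vf_coord_diff Ys ac cp).
rewrite Xp Yp in B; rewrite /vf_bracket -/c.
have E (Z W : vfield M) : smooth_vfield Z -> fdiff (fun q => fdiff f (Z q)) (W p) =
    'd (fun y => 'd phi y (vf_coord c Z y)) (cmap c p) (W p).
  move=> Zs; have := smooth_fun_on_fdifferentiable (smooth_fun_fdiff fs Zs) (I : setT p).
  move=> /(_ c ac cp)/differentiableP D.
  have D' : is_diff (cmap c p) (fun y => 'd phi y (vf_coord c Z y) : R^o)
      ('d ((fun q => fdiff f (Z q)) \o cinv c : _ -> R^o) (cmap c p)).
    apply: near_eq_is_diff D; apply: filterS nU => x cx /=.
    by rewrite fdiff_vf_coord.
  by symmetry; exact: (is_diffE (W p) D').
by rewrite (E Y X Ys) (E X Y Xs); exact: esym B.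
Qed.

(** In charts, relatedness says that the differential of F applied to the field X is X' composed
    with F. Differentiating this composite by the chain rule evaluates both terms of
    [diff_bracket]. *)
Lemma mdiff_bracket M N (F : M -> N) (X Y : vfield M) (X' Y' : vfield N) p :
  smooth_map F -> smooth_vfield X -> smooth_vfield Y ->
  smooth_vfield X' -> smooth_vfield Y' ->
  (forall q, mdiff F (X q) = X' (F q)) -> (forall q, mdiff F (Y q) = Y' (F q)) ->
  mdiff F (vf_bracket X Y p) = vf_bracket X' Y' (F p).
Proof.
move=> Fs Xs Ys Xs' Ys' FX FY.
have ac := chart_at_atlas p; have cp := chart_at_dom p; pose c := chart_at p.
have ad := chart_at_atlas (F p); have dp := chart_at_dom (F p).
pose d := chart_at (F p); pose phi := cmap d \o F \o cinv c.
have [Fc Fk] := Fs; have {}Fk := Fk c d ac ad.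
have oF : open (F @^-1` cdom d).
  by apply: open_comp => [q _|]; [exact: Fc|exact: (@cdom_open _ _ _ d)].
have oU := @open_cmap_image _ _ _ c _ oF.
have Ux : (cmap c @` (cdom c `&` F @^-1` cdom d)) (cmap c p) by exists p.
have nU := open_nbhs_nbhs (conj oU Ux).
have sym u v := diff_diff_row_sym u v oU Ux (Fk 2).
have Xp : vf_coord c X (cmap c p) = X p by rewrite vf_coord_cmap// tcoord_id.
have Yp : vf_coord c Y (cmap c p) = Y p by rewrite vf_coord_cmap// tcoord_id.
have B := diff_bracket oU Ux (Fk 2) sym
  (vf_coord_diff Xs ac cp) (vf_coord_diff Ys ac cp).
rewrite Xp Yp in B.
have phip : phi (cmap c p) = cmap d (F p) by rewrite /phi /= cinvK.
have [F1 _] := Fk 1; have /differentiableP dphi := F1 _ Ux.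
have E (Z W : vfield M) (Z' W' : vfield N) : smooth_vfield Z' ->
    (forall q, mdiff F (Z q) = Z' (F q)) -> (forall q, mdiff F (W q) = W' (F q)) ->
    'd (fun y => 'd phi y (vf_coord c Z y)) (cmap c p) (W p) =
    'd (vf_coord d Z') (cmap d (F p)) (W' (F p)).
  move=> Zs' FZ FW.
  have dZ : is_diff (phi (cmap c p)) (vf_coord d Z') ('d (vf_coord d Z') (cmap d (F p))).
    by rewrite phip; apply: differentiableP; exact: vf_coord_diff.
  have D := is_diff_comp dphi dZ.
  have D' : is_diff (cmap c p) (fun y => 'd phi y (vf_coord c Z y))
      ('d (vf_coord d Z') (cmap d (F p)) \o 'd phi (cmap c p)).
    apply: near_eq_is_diff D; apply: filterS nU => x; rewrite cmap_imageE => -[cx dx].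
    have cq := cdom_cinv cx; have Fq := smooth_map_mdifferentiable (cinv c x) Fs.
    have Eq : cinv d (phi x) = F (cinv c x) by rewrite /phi /= cinvK.
    have H y : cmap c (cinv c x) = y -> 'd phi y (vf_coord c Z x) =
        @tcoord _ _ _ d (F (cinv c x)) (mdiff F (Z (cinv c x))).
      by move=> <-; exact: esym (mdiffE (Z (cinv c x)) Fq ac ad cq dx).
    rewrite (H _ (cmap_cinv cx)) FZ /comp /vf_coord.
    by rewrite Eq.
  by rewrite -FW; exact: (is_diffE (W p) D').
apply: etrans (esym B) _.
exact: (congr2 (fun u v : 'rV[R]_n => u - v) (E Y X Y' X' Ys' FY FX)
  (E X Y X' Y' Xs' FX FY)).
Qed.

End SmoothFields.

(** * The Levi-Civita connection on left-invariant fields *)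

Section LeftInvariantGeometry.
Context {R : realType} {n : nat} {G : lieGroupType R n}.
Variables (ip : metric G) (nabla : vfield G -> vfield G -> vfield G).
Hypotheses (ipR : riemannian ip) (ipL : left_invariant ip)
  (LC : levi_civita ip nabla).
Local Notation e := (1%g : G).
Implicit Types (p q : G) (u v w xi eta zeta : 'rV[R]_n) (X Y Z W : vfield G).

(* Every tangent space unfolds to 'rV[R]_n; with that type, rewriting a base
   point does not run into dependent types. *)
Definition lbracket xi eta : 'rV[R]_n := @lie_bracket R n G xi eta.
Definition lconn xi eta : 'rV[R]_n := @conn_alg R n G nabla xi eta.
Local Notation fld xi := (phi xi : vfield G).

Definition ip_at p u v : R := ip (p := p) u v.

Lemma ip_atC p u v : ip_at p u v = ip_at p v u. Proof. exact: (riem_sym ipR). Qed.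

Lemma ip_atDl p u v w : ip_at p (u + v) w = ip_at p u w + ip_at p v w.
Proof. by have := riem_linear ipR (p := p) 1 u v w; rewrite scale1r mul1r. Qed.

Lemma ip_at0l p w : ip_at p 0 w = 0.
Proof.
by have := ip_atDl p 0 0 w; rewrite addr0 => /esym/eqP; rewrite -subr_eq0 addrK => /eqP.
Qed.

Lemma ip_atZl p k u w : ip_at p (k *: u) w = k * ip_at p u w.
Proof.
have := riem_linear ipR (p := p) k u (0 : 'rV[R]_n) w.
by rewrite addr0 => E; rewrite [LHS]E -[X in _ + X]/(ip_at p 0 w) ip_at0l addr0.
Qed.

Lemma ip_atBl p u v w : ip_at p (u - v) w = ip_at p u w - ip_at p v w.
Proof. by rewrite -scaleN1r ip_atDl ip_atZl mulN1r. Qed.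

Lemma ip_at_eq p u v : (forall w, ip_at p u w = ip_at p v w) -> u = v.
Proof.
move=> H; apply/eqP; rewrite -subr_eq0; apply/negPn/negP => uv0.
have := riem_pos ipR p uv0; rewrite -[ip _ _]/(ip_at p (u - v) (u - v)).
by rewrite ip_atBl H subrr ltxx.
Qed.

Lemma ip_at_dL x p u v : ip_at (x * p)%g (dL x p u) (dL x p v) = ip_at p u v.
Proof. exact: ipL. Qed.

Lemma ip_at_phi p xi eta : ip_at p (phi xi p) (phi eta p) = ip_at e xi eta.
Proof. by have := ip_at_dL p e xi eta; rewrite mulg1. Qed.

Lemma ip_at_left_coord p u v : ip_at e (left_coord p u) (left_coord p v) = ip_at p u v.
Proof. by rewrite -(ip_at_phi p) !phi_left_coord. Qed.

(* D is the inverse Gram matrix at the identity; it reduces the smoothness of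
   left-invariant coordinates to that of inner products. *)
Lemma gram_dual : exists D : 'M[R]_n, forall v,
  v = (\row_j ip_at e v (delta_mx 0 j)) *m D.
Proof.
pose gram := \matrix_(i, j) ip_at e (delta_mx 0 i) (delta_mx 0 j).
have E v : \row_j ip_at e v (delta_mx 0 j) = v *m gram.
  apply/rowP => j; rewrite !mxE {1}[v]row_sum_delta.
  have fD : {morph (fun u => ip_at e u (delta_mx 0 j)) : u w / u + w >-> u + w}.
    by move=> u w; exact: ip_atDl.
  rewrite (big_morph _ fD (ip_at0l e _)); apply: eq_bigr => i _.
  by rewrite ip_atZl mxE.
(* A row vector v annihilated by the Gram matrix would satisfy <v, v> = 0, against positivity. *)
have U : gram \in unitmx.
  rewrite unitmxE unitfE; apply/det0P => -[v v0 vg].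
  have := riem_pos ipR e v0; rewrite -[ip _ _]/(ip_at e v v).
  rewrite {2}[v]row_sum_delta ip_atC.
  have fD : {morph (fun u => ip_at e u v) : u w / u + w >-> u + w}.
    by move=> u w; exact: ip_atDl.
  rewrite (big_morph _ fD (ip_at0l e _)) big1 ?ltxx// => i _.
  rewrite ip_atZl ip_atC; have /rowP/(_ i) := E v; rewrite vg !mxE => ->.
  by rewrite mulr0.
by exists (invmx gram) => v; rewrite E mulmxK.
Qed.

Lemma smooth_fun_left_coord (U : set G) X j : open U -> smooth_vfield_on U X ->
  smooth_fun_on U (fun p => left_coord p (X p) 0 j).
Proof.
move=> oU Xs; have [D DE] := gram_dual.
have -> : (fun p => left_coord p (X p) 0 j) =
    (fun p => \sum_i ip (X p) (phi (delta_mx 0 i) p) * D i j).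
  apply/funext => p; rewrite [in LHS](DE (left_coord p (X p))) mxE.
  apply: eq_bigr => i _; rewrite mxE; congr (_ * _).
  by rewrite -[RHS]ip_at_left_coord left_coord_phi.
apply: (smooth_fun_sum _ _ oU) => i.
apply: (smooth_funM oU); first apply: (riem_smooth ipR oU Xs).
  move=> c ac k; apply: Ck_on_sub (phi_smooth _ ac k).
  by move=> x [q [cq Uq] <-]; exists q.
by move=> c ac k; exact: (Ck_on_cst _ _ (D i j : R^o)).
Qed.

(** Left-invariant fields are related to themselves by every left translation; naturality of the
    bracket is used from e to p. *)
Lemma phi_bracket xi eta p :
  vf_bracket (phi xi) (phi eta) p = phi (lbracket xi eta) p.
Proof.
have := @mdiff_bracket R n G G (Lmul p) (phi xi) (phi eta) (phi xi) (phi eta) e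
  (Lmul_smooth p) (phi_smooth xi) (phi_smooth eta) (phi_smooth xi)
  (phi_smooth eta) (fun q => dL_phi p q xi) (fun q => dL_phi p q eta).
by have -> : Lmul p e = p by exact: mulg1.
Qed.

(** Differentiating the constant <eta, zeta> shows that nabla_xi is skew-adjoint on left-invariant
    fields. *)
Lemma ip_at_conn_phi xi eta zeta p :
  ip_at p (nabla (fld xi) (fld eta) p) (phi zeta p) =
  - ip_at p (nabla (phi xi) (phi zeta) p) (phi eta p).
Proof.
have := lc_metric LC p (phi_smooth xi) (phi_smooth eta) (phi_smooth zeta).
have -> : (fun q => ip (phi eta q) (phi zeta q)) = (fun=> ip_at e eta zeta).
  by apply/funext => q; exact: ip_at_phi.
rewrite fdiff_cst => /esym/eqP; rewrite addr_eq0 => /eqP H.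
by rewrite /ip_at H (riem_sym ipR).
Qed.

Lemma conn_torsion X Y p : smooth_vfield X -> smooth_vfield Y ->
  (nabla X Y p : 'rV[R]_n) = vf_bracket X Y p + nabla Y X p.
Proof. by move=> Xs Ys; rewrite -(lc_torsion_free LC)// subrK. Qed.

(* The inner products of left-invariant fields are constant, so only the bracket
   terms of Koszul's formula remain. *)
Lemma koszul xi eta zeta p :
  2 * ip_at p (nabla (fld xi) (fld eta) p) (phi zeta p) =
  ip_at e (lbracket xi eta) zeta - ip_at e (lbracket eta zeta) xi
  + ip_at e (lbracket zeta xi) eta.
Proof.
have B u v w : ip_at e (lbracket u v) w =
    ip_at p (nabla (phi u) (phi v) p) (phi w p)
    - ip_at p (nabla (phi v) (phi u) p) (phi w p).
  rewrite -(ip_at_phi p) -phi_bracket -ip_atBl.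
  by rewrite (lc_torsion_free LC p (phi_smooth u) (phi_smooth v)).
rewrite !B (ip_at_conn_phi eta xi) (ip_at_conn_phi zeta xi) (ip_at_conn_phi xi zeta).
by ring.
Qed.

(** The right-hand side of [koszul] does not involve p, so the values at p and at e have the same
    inner products with the frame. *)
Lemma conn_phi xi eta p :
  nabla (fld xi) (fld eta) p = phi (lconn xi eta) p.
Proof.
apply: (ip_at_eq (p := p)) => w; rewrite -(phi_left_coord p w) ip_at_phi.
set zeta := left_coord p w.
have K1 := koszul xi eta zeta p; have := koszul xi eta zeta e.
rewrite -K1 [phi zeta e]/phi -[@mdiff _ _ _ _ _ _ zeta]/(dL e e zeta) dL1.
move/mulfI; rewrite pnatr_eq0 /= => H; exact: esym (H isT).
Qed.

(** By skewness -<nabla_xi xi, zeta> = <nabla_xi zeta, xi>. Torsion-freeness turns this into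
    <[xi, zeta], xi> + <nabla_zeta xi, xi>, whose last term vanishes, again by skewness. *)
Lemma ad_dagger_self xi :
  ad_dagger ip xi xi = - (lconn xi xi) :> 'rV[R]_n.
Proof.
have phi_at_e u : phi u e = u by rewrite [LHS](dL1 e u).
have P : forall zeta : tangent e, ip (p := e) (- (lconn xi xi)) zeta =
    ip (p := e) xi (lbracket xi zeta).
  move=> zeta; rewrite -[LHS]/(ip_at e _ zeta) -[RHS]/(ip_at e _ _).
  have N0 : ip_at e (nabla (phi zeta) (phi xi) e) (phi xi e) = 0.
    by have := ip_at_conn_phi zeta xi xi e; lra.
  rewrite -scaleN1r ip_atZl mulN1r -{1}[zeta]phi_at_e ip_at_conn_phi opprK.
  rewrite (conn_torsion e (phi_smooth xi) (phi_smooth zeta)) ip_atDl N0 addr0.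
  by rewrite phi_at_e ip_atC.
(* [P] provides a representative, so [xget] does not return its default 0; positivity makes the
   representative unique. *)
rewrite /ad_dagger; case: xgetP => [u _ /= Hu|/(_ (- (lconn xi xi)))].
  by apply: (ip_at_eq (p := e)) => w; rewrite /ip_at Hu P.
by move=> /= H; exfalso; exact: H.
Qed.

End LeftInvariantGeometry.

(** * Curvature and gradients *)

Section VectorIdentities.
Context {R : realType} {n : nat}.
Implicit Types a b c d x y : 'rV[R]_n.

Lemma addB3 a b c d x y :
  a + b - (c + d) - (x + y) = a - c - x + (b - d - y).
Proof. by apply/rowP => j; rewrite !mxE; ring. Qed.

(** For R(fX, Y)Z, [b] is (Y f) nabla_X Z: it comes from nabla_Y (f nabla_X Z) and again from
    [fX, Y]. *)
Lemma tensorial_left a b c d : a - (b + c) - (d - b) = a - c - d.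
Proof. by apply/rowP => j; rewrite !mxE; ring. Qed.

(** For R(X, Y)(fZ), [a] and [a'] are X(Y f) Z and Y(X f) Z, which [X, Y] f cancels; the mixed terms
    [b] and [c] occur in both iterated derivatives. *)
Lemma tensorial_right a b c d x y a' :
  a + b + (c + d) - (a' + c + (b + x)) - (a - a' + y) = d - x - y.
Proof. by apply/rowP => j; rewrite !mxE; ring. Qed.

End VectorIdentities.

Section Curvature.
Context {R : realType} {n : nat} {G : lieGroupType R n}.
Variables (ip : metric G) (nabla : vfield G -> vfield G -> vfield G).
Hypotheses (ipR : riemannian ip) (ipL : left_invariant ip)
  (LC : levi_civita ip nabla).
Local Notation e := (1%g : G).
Local Notation aff := (lc_connection LC).
Local Notation fld xi := (phi xi : vfield G).
Local Notation cN := (lconn nabla).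
Implicit Types (p q : G) (u v w xi eta zeta : 'rV[R]_n) (X Y Z W : vfield G).

Lemma phi_e u : phi u e = u.
Proof. exact: (dL1 e u). Qed.

Lemma fldD u v : fld (u + v) = (fun q => (phi u q : 'rV[R]_n) + phi v q).
Proof. by apply: functional_extensionality_dep => q; exact: phiD. Qed.

Lemma fldZ k u : fld (k *: u) = (fun q => k *: (phi u q : 'rV[R]_n)).
Proof. by apply: functional_extensionality_dep => q; exact: phiZ. Qed.

Lemma lconnDl u v w : cN (u + v) w = cN u w + cN v w.
Proof.
rewrite /lconn /conn_alg fldD.
exact: (connDl aff e (phi_smooth u) (phi_smooth v) (phi_smooth w)).
Qed.

Lemma lconnZl k u w : cN (k *: u) w = k *: cN u w.
Proof.
rewrite /lconn /conn_alg fldZ.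
exact: (connZl aff e (smooth_fun_cst k) (phi_smooth u) (phi_smooth w)).
Qed.

Lemma lconnDr u v w : cN u (v + w) = cN u v + cN u w.
Proof.
rewrite /lconn /conn_alg fldD.
exact: (connDr aff e (phi_smooth u) (phi_smooth v) (phi_smooth w)).
Qed.

Lemma lconnZr k u w : cN u (k *: w) = k *: cN u w.
Proof.
rewrite /lconn /conn_alg fldZ.
have := conn_leibniz aff e (smooth_fun_cst k) (phi_smooth u) (phi_smooth w).
by rewrite fdiff_cst scale0r add0r.
Qed.

Lemma frame_expansion X p : X p = \sum_j left_coord p (X p) 0 j *: phi (delta_mx 0 j) p.
Proof. by rewrite -[LHS](phi_left_coord p) [LHS]phi_sum. Qed.

Lemma smooth_vfield_sum (I : Type) (r : seq I) (P : pred I) (X : I -> vfield G) :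
  (forall i, smooth_vfield (X i)) ->
  smooth_vfield (fun p => \sum_(i <- r | P i) (X i p : 'rV[R]_n)).
Proof.
move=> Xs.
have E : (fun p => \sum_(i <- r | P i) (X i p : 'rV[R]_n)) =
    \sum_(i <- r | P i) (fun p => X i p : 'rV[R]_n).
  by rewrite fct_sumE.
have : smooth_vfield ((\sum_(i <- r | P i) (fun p => X i p : 'rV[R]_n)) : vfield G).
  elim/big_ind : _ => [|a b|i _]; last exact: Xs.
    have -> : (0 : G -> 'rV[R]_n) = fld 0.
      apply: functional_extensionality_dep => q.
      by rewrite -(scale0r (0 : 'rV[R]_n)) [RHS]phiZ !scale0r.
    exact: phi_smooth.
  exact: smooth_vfieldD.
by rewrite -E.
Qed.

(* The coefficients of X in the left-invariant frame are globally smooth, so no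
   bump functions are needed. *)
Lemma tensorial (T : vfield G -> 'rV[R]_n) p X :
  (forall X Y, smooth_vfield X -> smooth_vfield Y ->
    T (fun q => (X q : 'rV[R]_n) + Y q) = T X + T Y) ->
  (forall f X, smooth_fun f -> smooth_vfield X ->
    T (fun q => f q *: (X q : 'rV[R]_n)) = f p *: T X) ->
  smooth_vfield X -> T X = T (fld (left_coord p (X p))).
Proof.
move=> TD TZ Xs.
have T0 : T (fun _ : G => 0 : 'rV[R]_n) = 0.
  have -> : (fun _ : G => 0 : 'rV[R]_n) =
      (fun q => (0 : R) *: (fld 0 q : 'rV[R]_n)).
    by apply: functional_extensionality_dep => q; rewrite scale0r.
  by rewrite (TZ _ _ (smooth_fun_cst 0) (phi_smooth 0)) scale0r.
have TE (c : 'I_n -> G -> R) : (forall j, smooth_fun (c j)) ->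
    T (fun q => \sum_j c j q *: (phi (delta_mx 0 j) q : 'rV[R]_n)) =
    \sum_j c j p *: T (fld (delta_mx 0 j)).
  move=> cs; elim: (index_enum 'I_n) => [|j r IH].
    rewrite big_nil -[RHS]T0; congr (T _).
    by apply: functional_extensionality_dep => q; rewrite big_nil.
  rewrite big_cons -IH -(TZ _ _ (cs j) (phi_smooth _)) -TD.
  - by congr (T _); apply: functional_extensionality_dep => q; rewrite big_cons.
  - by apply: smooth_vfieldZ; [exact: cs|exact: phi_smooth].
  - apply: (@smooth_vfield_sum _ r xpredT
      (fun j q => c j q *: (phi (delta_mx 0 j) q : 'rV[R]_n))).
    by move=> i; apply: smooth_vfieldZ; [exact: cs|exact: phi_smooth].
have cX j : smooth_fun (fun q => left_coord q (X q) 0 j).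
  by apply: (smooth_fun_left_coord ipR ipL) => //; exact: openT.
have -> : T X = \sum_j left_coord p (X p) 0 j *: T (fld (delta_mx 0 j)).
  rewrite -(TE (fun j q => left_coord q (X q) 0 j) cX); congr (T _).
  by apply: functional_extensionality_dep => q; exact: frame_expansion.
(* The sum sees the coefficients only at p. Freezing them there yields the left-invariant field with
   the same value at p. *)
rewrite -(TE (fun j _ => left_coord p (X p) 0 j) (fun j => smooth_fun_cst _)).
by congr (T _); apply: functional_extensionality_dep => q; rewrite [RHS]phi_sum.
Qed.

Lemma connS X Y : smooth_vfield X -> smooth_vfield Y -> smooth_vfield (nabla X Y).
Proof. exact: (conn_smooth aff). Qed.

Lemma nablaDl X X' Y : smooth_vfield X -> smooth_vfield X' -> smooth_vfield Y ->
  nabla (fun q => (X q : 'rV[R]_n) + X' q) Y =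
  (fun q => (nabla X Y q : 'rV[R]_n) + nabla X' Y q).
Proof.
by move=> *; apply: functional_extensionality_dep => q; exact: (connDl aff).
Qed.

Lemma nablaDr X Y Y' : smooth_vfield X -> smooth_vfield Y -> smooth_vfield Y' ->
  nabla X (fun q => (Y q : 'rV[R]_n) + Y' q) =
  (fun q => (nabla X Y q : 'rV[R]_n) + nabla X Y' q).
Proof.
by move=> *; apply: functional_extensionality_dep => q; exact: (connDr aff).
Qed.

Lemma nablaZl f X Y : smooth_fun f -> smooth_vfield X -> smooth_vfield Y ->
  nabla (fun q => f q *: (X q : 'rV[R]_n)) Y =
  (fun q => f q *: (nabla X Y q : 'rV[R]_n)).
Proof.
by move=> *; apply: functional_extensionality_dep => q; exact: (connZl aff).
Qed.

Lemma nablaZr f X Y : smooth_fun f -> smooth_vfield X -> smooth_vfield Y ->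
  nabla X (fun q => f q *: (Y q : 'rV[R]_n)) =
  (fun q => fdiff f (X q) *: (Y q : 'rV[R]_n) + f q *: (nabla X Y q : 'rV[R]_n)).
Proof.
by move=> *; apply: functional_extensionality_dep => q; exact: (conn_leibniz aff).
Qed.

(** Torsion-freeness lets the smoothness and the linearity rules of the bracket follow from the
    connection axioms instead of chart computations. *)
Lemma bracketE X Y : smooth_vfield X -> smooth_vfield Y ->
  vf_bracket X Y = (fun q => (nabla X Y q : 'rV[R]_n) + (-1) *: (nabla Y X q : 'rV[R]_n)).
Proof.
move=> Xs Ys; apply: functional_extensionality_dep => q.
by rewrite scaleN1r -(lc_torsion_free LC).
Qed.

Lemma bracketS X Y : smooth_vfield X -> smooth_vfield Y ->
  smooth_vfield (vf_bracket X Y).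
Proof.
move=> Xs Ys; rewrite bracketE//; apply: smooth_vfieldD; first exact: connS.
by apply: (smooth_vfieldZ (f := fun=> -1)); [exact: smooth_fun_cst|exact: connS].
Qed.

Lemma curvature_antisym X Y Z p : smooth_vfield X -> smooth_vfield Y ->
  smooth_vfield Z ->
  curvature nabla Y X Z p = (-1) *: (curvature nabla X Y Z p : 'rV[R]_n) :> 'rV[R]_n.
Proof.
move=> Xs Ys Zs; rewrite /curvature.
have -> : vf_bracket Y X = (fun q => (-1) *: (vf_bracket X Y q : 'rV[R]_n)).
  apply: functional_extensionality_dep => q; rewrite !bracketE// scalerDr.
  by rewrite scalerA mulrNN mulr1 scale1r addrC.
rewrite (nablaZl (smooth_fun_cst (-1)) (bracketS Xs Ys) Zs).
by rewrite !scalerDr !scalerN !scaleN1r !opprK [X in X + _]addrC.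
Qed.

Lemma curvature_tensorial1 X Y Z p : smooth_vfield X -> smooth_vfield Y ->
  smooth_vfield Z ->
  curvature nabla X Y Z p = curvature nabla (fld (left_coord p (X p))) Y Z p.
Proof.
move=> Xs Ys Zs; apply: (tensorial (T := fun X => curvature nabla X Y Z p)) => //.
  move=> X1 X2 X1s X2s; rewrite /curvature.
  have -> : vf_bracket (fun q => (X1 q : 'rV[R]_n) + X2 q) Y =
      (fun q => (vf_bracket X1 Y q : 'rV[R]_n) + vf_bracket X2 Y q).
    rewrite !bracketE//; last exact: smooth_vfieldD.
    rewrite nablaDl// nablaDr//; apply: functional_extensionality_dep => q.
    by rewrite scalerDr addrACA.
  rewrite (nablaDl X1s X2s (connS Ys Zs)) (nablaDl X1s X2s Zs).
  rewrite (nablaDl (bracketS X1s Ys) (bracketS X2s Ys) Zs).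
  rewrite (nablaDr Ys (connS X1s Zs) (connS X2s Zs)).
  exact: addB3.
move=> f X1 fs X1s; rewrite /curvature.
have fY : smooth_fun (fun q => fdiff f (Y q)) by exact: smooth_fun_fdiff.
have -> : vf_bracket (fun q => f q *: (X1 q : 'rV[R]_n)) Y =
    (fun q => f q *: (vf_bracket X1 Y q : 'rV[R]_n)
            + (-1) *: (fdiff f (Y q) *: (X1 q : 'rV[R]_n))).
  rewrite !bracketE//; last exact: smooth_vfieldZ.
  rewrite nablaZl// nablaZr//; apply: functional_extensionality_dep => q.
  rewrite !scalerDr !scalerA [f q * -1]mulrC -addrA; congr (_ + _).
  exact: addrC.
have fXs := smooth_vfieldZ fY X1s.
rewrite (nablaDl (smooth_vfieldZ fs (bracketS X1s Ys))
  (smooth_vfieldZ (smooth_fun_cst (-1)) fXs) Zs).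
rewrite (nablaZl (smooth_fun_cst (-1)) fXs Zs) (nablaZl fY X1s Zs).
rewrite (nablaZl fs (bracketS X1s Ys) Zs) (nablaZl fs X1s (connS Ys Zs)).
rewrite (nablaZl fs X1s Zs) (nablaZr fs Ys (connS X1s Zs)).
rewrite scaleN1r !scalerBr; exact: tensorial_left.
Qed.

Lemma curvature_tensorial2 X Y Z p : smooth_vfield X -> smooth_vfield Y ->
  smooth_vfield Z ->
  curvature nabla X Y Z p = curvature nabla X (fld (left_coord p (Y p))) Z p.
Proof.
move=> Xs Ys Zs; rewrite curvature_antisym// curvature_tensorial1//.
by rewrite -curvature_antisym//; exact: phi_smooth.
Qed.

Lemma curvature_tensorial3 X Y Z p : smooth_vfield X -> smooth_vfield Y ->
  smooth_vfield Z ->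
  curvature nabla X Y Z p = curvature nabla X Y (fld (left_coord p (Z p))) p.
Proof.
move=> Xs Ys Zs; apply: (tensorial (T := fun Z => curvature nabla X Y Z p)) => //.
  move=> Z1 Z2 Z1s Z2s; rewrite /curvature.
  rewrite (nablaDr Xs Z1s Z2s) (nablaDr Ys Z1s Z2s) (nablaDr (bracketS Xs Ys) Z1s Z2s).
  rewrite (nablaDr Xs (connS Ys Z1s) (connS Ys Z2s)).
  rewrite (nablaDr Ys (connS Xs Z1s) (connS Xs Z2s)).
  exact: addB3.
move=> f Z1 fs Z1s; rewrite /curvature.
have fX : smooth_fun (fun q => fdiff f (X q)) by exact: smooth_fun_fdiff.
have fY : smooth_fun (fun q => fdiff f (Y q)) by exact: smooth_fun_fdiff.
have XZ := connS Xs Z1s; have YZ := connS Ys Z1s; have XYs := bracketS Xs Ys.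
rewrite (nablaZr fs Ys Z1s) (nablaZr fs Xs Z1s) (nablaZr fs XYs Z1s).
rewrite (nablaDr Xs (smooth_vfieldZ fY Z1s) (smooth_vfieldZ fs YZ)).
rewrite (nablaDr Ys (smooth_vfieldZ fX Z1s) (smooth_vfieldZ fs XZ)).
rewrite (nablaZr fY Xs Z1s) (nablaZr fs Xs YZ) (nablaZr fX Ys Z1s) (nablaZr fs Ys XZ).
rewrite (fdiff_bracket p fs Xs Ys).
rewrite !scalerBr scalerBl; exact: tensorial_right.
Qed.

Lemma fld_conn u v : nabla (fld u) (fld v) = fld (cN u v).
Proof.
by apply: functional_extensionality_dep => q; exact: (conn_phi ipR ipL LC).
Qed.

Lemma phiB u v p : phi (u - v) p = phi u p - phi v p :> 'rV[R]_n.
Proof. by rewrite -scaleN1r [LHS]phiD [X in _ + X]phiZ scaleN1r. Qed.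

Definition lcurvature u v w : 'rV[R]_n :=
  cN u (cN v w) - cN v (cN u w) - cN (@lbracket R n G u v) w.

Lemma curvature_phi u v w p :
  curvature nabla (fld u) (fld v) (fld w) p = phi (lcurvature u v w) p.
Proof.
rewrite /curvature /lcurvature !phiB !fld_conn.
have -> : vf_bracket (fld u) (fld v) = fld (@lbracket R n G u v).
  by apply: functional_extensionality_dep => q; exact: phi_bracket.
by rewrite fld_conn.
Qed.

(** The left-invariant field through u is an extension, so [xget] does not return its default. *)
Lemma extensionP p u :
  smooth_vfield (@extension R n G p u) /\ @extension R n G p u p = u.
Proof.
rewrite /extension; case: xgetP => [X _ //|/(_ (fld (left_coord p u))) /= H].
by exfalso; apply: H; split; [exact: phi_smooth|exact: phi_left_coord].
Qed.

Lemma curvature_atE p u v w :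
  @curvature_at R n G nabla p u v w =
  phi (lcurvature (left_coord p u) (left_coord p v) (left_coord p w)) p.
Proof.
have [us uE] := extensionP p u; have [vs vE] := extensionP p v.
have [ws wE] := extensionP p w.
rewrite /curvature_at (curvature_tensorial1 p us vs ws).
rewrite (curvature_tensorial2 p (phi_smooth _) vs ws).
rewrite (curvature_tensorial3 p (phi_smooth _) (phi_smooth _) ws).
by rewrite uE vE wE; exact: curvature_phi.
Qed.

Lemma left_coord_e u : left_coord e u = u.
Proof. by rewrite -{1}(phi_e u) left_coord_phi. Qed.

Lemma left_coord_curvature_at p u v w :
  left_coord p (@curvature_at R n G nabla p u v w) =
  @curvature_at R n G nabla e (left_coord p u) (left_coord p v) (left_coord p w).
Proof. by rewrite !curvature_atE left_coord_phi !left_coord_e [RHS]phi_e. Qed.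

Lemma gradE (f : G -> R) p : grad ip f p =
  xget 0 [set u : 'rV[R]_n | forall v, ip_at ip p u v = @fdiff _ _ _ f p v].
Proof. by []. Qed.

(* Left translation is an isometry, so it maps representatives of the
   differential of f \o Lmul x to those of f.  It also preserves 0, the value of
   grad when there is no representative. *)
Lemma dL_grad (f : G -> R) x p : fdifferentiable f (x * p)%g ->
  dL x p (grad ip (f \o Lmul x) p) = grad ip f (x * p)%g.
Proof.
move=> fd.
have fE v : @fdiff _ _ _ (f \o Lmul x) p v = @fdiff _ _ _ f (x * p)%g (dL x p v).
  exact: (fdiff_comp v (Lmul_mdiff x p) fd).
have dLK' v : dL x p (dL x^-1%g (x * p)%g v) = v.
  by have := dLVK x (x * p)%g v; rewrite mulKg.
have rep u : (forall v, ip_at ip p u v = @fdiff _ _ _ (f \o Lmul x) p v) <->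
    (forall v, ip_at ip (x * p)%g (dL x p u) v = @fdiff _ _ _ f (x * p)%g v).
  split=> H v; last by rewrite -(ip_at_dL ipL x) H fE.
  by rewrite -(dLK' v) (ip_at_dL ipL) H fE.
pose S1 : set 'rV[R]_n :=
  [set u | forall v, ip_at ip p u v = @fdiff _ _ _ (f \o Lmul x) p v].
pose S2 : set 'rV[R]_n :=
  [set u | forall v, ip_at ip (x * p)%g u v = @fdiff _ _ _ f (x * p)%g v].
have g1 : grad ip (f \o Lmul x) p = xget 0 S1 := gradE (f \o Lmul x) p.
have g2 : grad ip f (x * p)%g = xget 0 S2 := gradE f (x * p)%g.
rewrite g1 g2; have [[u Hu]|N1] := pselect (exists u, S1 u).
  have H1 : S1 (xget 0 S1) by apply: xgetPex; exists u.
  have H2 : S2 (xget 0 S2) by apply: xgetPex; exists (dL x p u); exact: (rep u).1.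
  apply: (ip_at_eq ipR (p := (x * p)%g)) => v.
  exact: etrans ((rep _).1 H1 v) (esym (H2 v)).
have E1 : xget 0 S1 = 0 by apply: xgetPN => u Hu; apply: N1; exists u.
have E2 : xget 0 S2 = 0.
  apply: xgetPN => w Hw; apply: N1; exists (dL x^-1%g (x * p)%g w).
  by apply/rep => v; rewrite dLK'; exact: Hw.
exact: etrans (congr1 (dL x p) E1) (etrans (dL0 x p) (esym E2)).
Qed.

End Curvature.

(** * Fields along curves *)

Section LinearAlongCurves.
Context {R : realType} {n : nat} (I : set R).
Hypothesis I_limit : forall t, I t -> ProperFilter (within I t^').
Implicit Types (u v : R -> 'rV[R]_n) (l m : 'rV[R]_n).

Lemma Ck_rel_row J k v : relopen I J ->
  (forall j, Ck_rel I J k (fun t => v t 0 j : R^o)) -> Ck_rel I J k v.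
Proof.
move=> oJ H.
have -> : v = (fun t => \sum_j (v t 0 j : R^o) *: (delta_mx 0 j : 'rV[R]_n)).
  by apply/funext => t; exact: row_sum_delta.
apply: (Ck_rel_sum I_limit _ _ oJ) => j.
exact: (Ck_relZ I_limit oJ (H j) (Ck_rel_cst I_limit k _ oJ)).
Qed.

Lemma is_wder_sum (V : normedModType R) (T : Type) (r : seq T) (P : pred T)
    (f : T -> R -> V) (df : T -> V) t :
  (forall i, is_wder I (f i) t (df i)) ->
  is_wder I (fun s => \sum_(i <- r | P i) f i s) t (\sum_(i <- r | P i) df i).
Proof.
move=> H; rewrite -fct_sumE.
elim/big_ind2 : _ => [|x1 x2 y1 y2|//]; first exact: is_wder_cst.
exact: is_wderD.
Qed.

Section Bilinear.
Variable B : 'rV[R]_n -> 'rV[R]_n -> 'rV[R]_n.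
Hypotheses (BDl : forall x y z, B (x + y) z = B x z + B y z)
  (BZl : forall k x z, B (k *: x) z = k *: B x z)
  (BDr : forall x y z, B x (y + z) = B x y + B x z)
  (BZr : forall k x z, B x (k *: z) = k *: B x z).

Lemma bilinear_expandl x z : B x z = \sum_j x 0 j *: B (delta_mx 0 j) z.
Proof.
have B0 : B 0 z = 0 by rewrite -(scale0r (0 : 'rV[R]_n)) BZl !scale0r.
rewrite {1}[x]row_sum_delta.
have fD : {morph (B^~ z) : x y / x + y >-> x + y} by move=> *; exact: BDl.
by rewrite (big_morph _ fD B0); apply: eq_bigr => j _; exact: BZl.
Qed.

Lemma bilinear_expandr x z : B x z = \sum_j z 0 j *: B x (delta_mx 0 j).
Proof.
have B0 : B x 0 = 0 by rewrite -(scale0r (0 : 'rV[R]_n)) BZr !scale0r.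
rewrite {1}[z]row_sum_delta.
have fD : {morph (B x) : y z / y + z >-> y + z} by move=> *; exact: BDr.
by rewrite (big_morph _ fD B0); apply: eq_bigr => j _; exact: BZr.
Qed.

(** Meant for [lconn], of which only the algebraic laws are at hand: in the standard basis B (u t)
    (v t) is a sum of products of coordinates with constant vectors. *)
Lemma Ck_rel_bilinear J k u v : relopen I J -> Ck_rel I J k u ->
  Ck_rel I J k v -> Ck_rel I J k (fun t => B (u t) (v t)).
Proof.
move=> oJ uk vk.
have -> : (fun t => B (u t) (v t)) = (fun t => \sum_i (u t 0 i : R^o) *:
    \sum_j (v t 0 j : R^o) *: B (delta_mx 0 i) (delta_mx 0 j)).
  apply/funext => t; rewrite bilinear_expandl; apply: eq_bigr => i _.
  by rewrite [B _ _]bilinear_expandr.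
apply: (Ck_rel_sum I_limit _ _ oJ) => i.
apply: (Ck_relZ I_limit oJ (Ck_rel_coord I_limit i oJ uk)).
apply: (Ck_rel_sum I_limit _ _ oJ) => j.
exact: (Ck_relZ I_limit oJ (Ck_rel_coord I_limit j oJ vk) (Ck_rel_cst I_limit k _ oJ)).
Qed.

Lemma is_wder_bilinear u v t l m : is_wder I u t l -> is_wder I v t m ->
  is_wder I (fun s => B (u s) (v s)) t (B l (v t) + B (u t) m).
Proof.
move=> ul vm.
have Bi i : is_wder I (fun s => B (delta_mx 0 i) (v s)) t (B (delta_mx 0 i) m).
  rewrite bilinear_expandr.
  have -> : (fun s => B (delta_mx 0 i) (v s)) =
      (fun s => \sum_j (v s 0 j : R^o) *: B (delta_mx 0 i) (delta_mx 0 j)).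
    by apply/funext => s; rewrite bilinear_expandr.
  apply: (@is_wder_sum _ _ _ xpredT
    (fun j s => (v s 0 j : R^o) *: B (delta_mx 0 i) (delta_mx 0 j))
    (fun j => m 0 j *: B (delta_mx 0 i) (delta_mx 0 j))) => j.
  have := is_wderZ (is_wder_coord (j := j) vm)
    (is_wder_cst I (B (delta_mx 0 i) (delta_mx 0 j)) t).
  by rewrite scaler0 addr0.
rewrite [B l _]bilinear_expandl [B (u t) _]bilinear_expandl -big_split /=.
have -> : (fun s => B (u s) (v s)) =
    (fun s => \sum_i (u s 0 i : R^o) *: B (delta_mx 0 i) (v s)).
  by apply/funext => s; rewrite bilinear_expandl.
apply: (@is_wder_sum _ _ _ xpredT
  (fun i s => (u s 0 i : R^o) *: B (delta_mx 0 i) (v s))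
  (fun i => l 0 i *: B (delta_mx 0 i) (v t) + u t 0 i *: B (delta_mx 0 i) m)) => i.
exact: (is_wderZ (is_wder_coord (j := i) ul) (Bi i)).
Qed.

End Bilinear.
End LinearAlongCurves.

(** * Coordinate vector fields of a chart *)

Section CoordinateFields.
Context {R : realType} {n : nat} {M : manifoldType R n}.
Implicit Types (c d : chart R n M) (p : M).

(** The field d/dx^j of c, written in the chart [chart_at p]; it is meaningful on [cdom c] only. *)
Definition coord_field c (j : 'I_n) : vfield M := fun p =>
  'd (cmap (chart_at p) \o cinv c) (cmap c p) (delta_mx 0 j).

Lemma coord_field_sum c p (v : 'rV[R]_n) : atlas c -> cdom c p ->
  v = \sum_j @tcoord _ _ M c p v 0 j *: (coord_field c j p : 'rV[R]_n).
Proof.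
move=> ac cp; rewrite -[LHS](tcoord_id p).
rewrite (tcoord_chart v ac (chart_at_atlas p) cp (chart_at_dom p)).
exact: diff_row_sum.
Qed.

Lemma tcoord_coord_field c d j p : atlas c -> atlas d -> cdom c p -> cdom d p ->
  tcoord d (coord_field c j p) = 'd (cmap d \o cinv c) (cmap c p) (delta_mx 0 j).
Proof.
move=> ac ad cp dp; have ap := chart_at_atlas p; have pp := chart_at_dom p.
have Ip := mdifferentiable_id p; symmetry.
exact: (is_diffE _ (is_diff_chart_comp (F := id) cp pp Ip.1
  (is_diff_chart Ip ap ad pp dp) (is_diff_chart Ip ac ap cp pp))).
Qed.

Lemma coord_field_smooth c j : atlas c -> smooth_vfield_on (cdom c) (coord_field c j).
Proof.
move=> ac d ad k.
have odc := @open_cmap_image _ _ _ d _ (@cdom_open _ _ _ c).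
have ocd := @open_cmap_image _ _ _ c _ (@cdom_open _ _ _ d).
have [_ H] := atlas_smooth _ _ ac ad k.+1.
have K := Ck_on_comp odc ocd _ (H (delta_mx 0 j)) (atlas_smooth _ _ ad ac k).
apply: (Ck_on_eq odc _ (K _)) => [x|x]; rewrite !cmap_imageE => -[dx cx].
  rewrite /= /vf_coord tcoord_coord_field//; exact: cdom_cinv.
split; first exact: cimg_cmap.
by rewrite /= cinvK//; exact: cdom_cinv.
Qed.

End CoordinateFields.

(** * Velocities and covariant derivatives in the left-invariant frame *)

Section LieCurves.
Context {R : realType} {n : nat} {G : lieGroupType R n}.
Variables (a b : R).
Hypothesis ab : a < b.
Local Notation I := (`[a, b]%classic : set R).
Local Notation HI := (fun t => @limit_point_itvcc R a b t ab).
Implicit Types (g : R -> G) (c d : chart R n G) (u v : R -> 'rV[R]_n).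

Lemma relopen_chart g c : {within I, continuous g} ->
  relopen I (I `&` g @^-1` cdom c).
Proof. by move=> gc; apply: relopen_preimage gc (@cdom_open _ _ _ c). Qed.

Lemma smooth_withinP (V : normedModType R) (f : R -> V) :
  smooth_within `[a, b] f <-> forall k, Ck_rel I I k f.
Proof. by split=> H k; apply/(Ck_withinP HI _ _ (relopenT I)); exact: H. Qed.

Lemma curve_Ck_rel g k c : curve_Ck a b k g -> atlas c ->
  Ck_rel I (I `&` g @^-1` cdom c) k (cmap c \o g).
Proof.
by move=> [gc gk] ac; apply/(Ck_withinP HI _ _ (relopen_chart c gc)); exact: gk.
Qed.

Lemma is_wder_chart g F c d t l : {within I, continuous g} -> I t ->
  mdifferentiable F (g t) -> atlas c -> atlas d -> cdom c (g t) ->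
  cdom d (F (g t)) -> is_wder I (cmap c \o g) t l ->
  is_wder I (cmap d \o (F \o g)) t ('d (cmap d \o F \o cinv c) (cmap c (g t)) l).
Proof.
move=> gc It Fg ac ad cg dF gl.
apply: (is_wder_eq _ It (is_wder_comp gl (is_diff_chart Fg ac ad cg dF))).
have := relopen_near (relopen_chart c gc) (conj It cg).
by apply: filterS => s H Is; have [_ cs] := H Is; rewrite /= cinvK.
Qed.

Lemma is_wder_velocity g t : curve_Ck a b 1 g -> I t ->
  is_wder I (cmap (chart_at (g t)) \o g) t (velocity a b g t).
Proof.
move=> g1 It; have [H _] := curve_Ck_rel g1 (chart_at_atlas (g t)).
by apply: (wderivableP (H t _)); split=> //; exact: chart_at_dom.
Qed.

Lemma tcoord_velocity g c t : curve_Ck a b 1 g -> I t -> atlas c ->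
  cdom c (g t) -> tcoord c (velocity a b g t) = wderive I (cmap c \o g) t.
Proof.
move=> g1 It ac cg; symmetry; apply: (is_wderE HI It).
exact: (is_wder_chart g1.1 It (mdifferentiable_id (g t)) (chart_at_atlas _) ac
  (chart_at_dom _) cg (is_wder_velocity g1 It)).
Qed.

Lemma velocity_Lmul x g t : curve_Ck a b 1 g -> I t ->
  velocity a b (fun s => (x * g s)%g) t = dL x (g t) (velocity a b g t).
Proof.
move=> g1 It; apply: (is_wderE HI It).
exact: (is_wder_chart g1.1 It (Lmul_mdiff x (g t)) (chart_at_atlas _)
  (chart_at_atlas _) (chart_at_dom _) (chart_at_dom _) (is_wder_velocity g1 It)).
Qed.

Lemma curve_smooth_Lmul x g : curve_smooth a b g ->
  curve_smooth a b (fun s => (x * g s)%g).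
Proof.
move=> gs k; have [gc _] := gs k.
have hc : {within I, continuous (fun s => (x * g s)%g)}.
  apply/subspace_continuousP => t It; move/subspace_continuousP: gc => gc.
  exact: (cvg_comp _ _ (gc t It) (@Lmul_cont _ _ _ x (g t))).
split=> // d ad; apply/(Ck_withinP HI _ _ (relopen_chart d hc)).
(* A chart around g t and the given chart d around x * g t are available together only for times
   near t. *)
apply: Ck_rel_local => t [It dt].
pose c := chart_at (g t); have ac : atlas c := chart_at_atlas (g t).
have [_ Ls] := Lmul_smooth x.
have oF : open (Lmul x @^-1` cdom d).
  by apply: open_comp => [q _|]; [exact: Lmul_cont|exact: (@cdom_open _ _ _ d)].
exists (I `&` g @^-1` cdom c `&` (I `&` (fun s => (x * g s)%g) @^-1` cdom d)).
  by split=> //; split=> //; exact: chart_at_dom.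
have oJ := relopenI (relopen_chart c gc) (relopen_chart d hc).
apply: (Ck_rel_eq HI oJ (f := (cmap d \o Lmul x \o cinv c) \o (cmap c \o g))).
  by move=> s [[_ cs] _]; rewrite /= cinvK.
apply: (Ck_rel_comp HI oJ (@open_cmap_image _ _ _ c _ oF)).
- by move=> s [[_ cs] [_ ds]]; exists (g s).
- exact: Ls.
- by apply: Ck_rel_sub (curve_Ck_rel (gs k) ac) => s [].
Qed.

Lemma Ck_rel_field g (X : vfield G) c k : curve_smooth a b g -> smooth_vfield X ->
  atlas c -> Ck_rel I (I `&` g @^-1` cdom c) k (fun t => tcoord c (X (g t))).
Proof.
move=> gs Xs ac; have oJ := relopen_chart c (gs 0).1.
apply: (Ck_rel_eq HI oJ (f := vf_coord c X \o (cmap c \o g))).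
  by move=> s [_ cs] /=; rewrite vf_coord_cmap.
apply: (Ck_rel_comp HI oJ (@open_cmap_image _ _ _ c _ (@openT G))).
- by move=> s [_ cs]; exists (g s).
- exact: Xs.
- exact: curve_Ck_rel.
Qed.

Lemma smooth_along_phi g u (W : forall t, tangent (g t)) :
  curve_smooth a b g -> (forall k, Ck_rel I I k u) ->
  (forall t, I t -> W t = phi (u t) (g t)) -> smooth_along a b W.
Proof.
move=> gs us WE c ac k; have oJ := relopen_chart c (gs 0).1.
apply/(Ck_withinP HI _ _ oJ).
apply: (Ck_rel_eq HI oJ (f := fun t => \sum_j (u t 0 j : R^o) *:
  (tcoord c ((phi (delta_mx 0 j) : vfield G) (g t)) : 'rV[R]_n))).
  move=> t [It ct]; rewrite WE// [phi (u t) (g t)]phi_sum.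
  pose L := ('d (cmap c \o cinv (chart_at (g t))) (cmap (chart_at (g t)) (g t))).
  rewrite -[RHS]/(L _) linear_sum; apply: eq_bigr => j _.
  by rewrite linearZ.
apply: (Ck_rel_sum HI _ _ oJ) => j; apply: (Ck_relZ HI oJ).
  apply: (Ck_rel_coord HI j oJ); apply: Ck_rel_sub (us k); exact: subIsetl.
by apply: Ck_rel_field => //; exact: phi_smooth.
Qed.

Section Metric.
Variables (ip : metric G) (nabla : vfield G -> vfield G -> vfield G).
Hypotheses (ipR : riemannian ip) (ipL : left_invariant ip)
  (LC : levi_civita ip nabla).
Local Notation fld xi := (phi xi : vfield G).

(** The velocity is not the restriction of a given field on G, so it is expanded in coordinate
    fields: its coefficients are derivatives of the curve in the chart, and the left coordinates of
    the coordinate fields are smooth on the chart domain. *)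
Lemma left_velocity_smooth g : curve_smooth a b g ->
  forall k, Ck_rel I I k (left_velocity a b g : R -> 'rV[R]_n).
Proof.
move=> gs k; apply: Ck_rel_local => t It.
pose c := chart_at (g t); have ac : atlas c := chart_at_atlas (g t).
have oJ := relopen_chart c (gs 0).1.
exists (I `&` g @^-1` cdom c); first by split=> //; exact: chart_at_dom.
apply: (Ck_rel_row HI oJ) => j.
pose F i p : R := left_coord p (coord_field c i p) 0 j.
apply: (Ck_rel_eq HI oJ (f := fun t => \sum_i
  (wderive I (cmap c \o g) t 0 i : R^o) *: (F i (g t) : R^o))).
  move=> s [Is cs]; rewrite /left_velocity.
  rewrite -[mdiff _ _]/(left_coord (g s) (velocity a b g s)).
  rewrite [in RHS](coord_field_sum (velocity a b g s) ac cs).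
  have fD : {morph (left_coord (g s)) : x y / x + y >-> x + y}.
    by move=> *; exact: left_coordD.
  rewrite (big_morph _ fD (dL0 _ _)) summxE; apply: eq_bigr => i _.
  by rewrite left_coordZ mxE (tcoord_velocity (gs 1) Is ac cs).
apply: (Ck_rel_sum HI _ _ oJ) => i; apply: (Ck_relZ HI oJ).
  by apply: (Ck_rel_coord HI i oJ); have [_] := curve_Ck_rel (gs k.+1) ac.
apply: (Ck_rel_eq HI oJ (f := (F i \o cinv c : _ -> R^o) \o (cmap c \o g))).
  by move=> s [_ cs]; rewrite /= cinvK.
have oc := @cdom_open _ _ _ c.
apply: (Ck_rel_comp HI oJ (@open_cmap_image _ _ _ c _ oc)).
- by move=> s [_ cs]; exists (g s).
- exact: (smooth_fun_left_coord ipR ipL j oc (coord_field_smooth i ac)).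
- exact: curve_Ck_rel.
Qed.

Lemma left_velocityE g t : velocity a b g t = phi (left_velocity a b g t) (g t).
Proof. by rewrite [RHS](phi_left_coord (g t)). Qed.

(* W is expanded in the left-invariant frame for all times in R, not just in
   [a, b]: D is only known to be linear on fields defined everywhere. *)
Lemma covariant_derivative_phi g D u (W : forall t, tangent (g t)) :
  curve_smooth a b g -> covariant_derivative nabla a b (g := g) D ->
  (forall k, Ck_rel I I k u) -> (forall t, I t -> W t = phi (u t) (g t)) ->
  forall t, I t ->
  D W t = phi (wderive I u t + lconn nabla (left_velocity a b g t) (u t)) (g t).
Proof.
move=> gs cD us WE t It.
pose w s : 'rV[R]_n := left_coord (g s) (W s).
have wu s : I s -> w s = u s by move=> Is; rewrite /w WE// left_coord_phi.
have ws k : Ck_rel I I k w.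
  by apply: (Ck_rel_eq HI (relopenT I) _ (us k)) => s /wu.
pose E j s : tangent (g s) := phi (delta_mx 0 j) (g s).
have WD : W = (fun s => \sum_j w s 0 j *: (E j s : 'rV[R]_n)).
  apply: functional_extensionality_dep => s.
  by rewrite -[LHS](phi_left_coord (g s)) [LHS]phi_sum.
have Es j : smooth_along a b (E j).
  apply: (smooth_along_phi (u := fun=> delta_mx 0 j)) => // k.
  exact: (Ck_rel_cst HI k _ (relopenT I)).
have wEs j : @smooth_along R n G a b g (fun s => w s 0 j *: (E j s : 'rV[R]_n)).
  apply: (@smooth_along_phi g (fun s => (w s 0 j : R^o) *: delta_mx 0 j)
    (fun s => w s 0 j *: (E j s : 'rV[R]_n))) => // [k|s _].
    apply: (Ck_relZ HI (relopenT I)).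
      exact: (Ck_rel_coord HI j (relopenT I) (ws k)).
    exact: (Ck_rel_cst HI k _ (relopenT I)).
  by rewrite [RHS]phiZ.
have sums (r : seq 'I_n) : @smooth_along R n G a b g
    (fun s => \sum_(j <- r) w s 0 j *: (E j s : 'rV[R]_n)).
  apply: (@smooth_along_phi g
    (fun s => \sum_(j <- r) (w s 0 j : R^o) *: delta_mx 0 j)
    (fun s => \sum_(j <- r) w s 0 j *: (E j s : 'rV[R]_n))) => // [k|s _].
    apply: (Ck_rel_sum HI _ _ (relopenT I)) => j; apply: (Ck_relZ HI (relopenT I)).
      exact: (Ck_rel_coord HI j (relopenT I) (ws k)).
    exact: (Ck_rel_cst HI k _ (relopenT I)).
  have fD : {morph ((@phi R n G)^~ (g s)) : x y / x + y >-> x + y}.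
    by move=> *; exact: phiD.
  rewrite (big_morph _ fD (dL0 _ _)); apply: eq_bigr => j _.
  by rewrite [RHS]phiZ.
have Dsum (r : seq 'I_n) : D (fun s => \sum_(j <- r) w s 0 j *: (E j s : 'rV[R]_n)) t =
    \sum_(j <- r) (D (fun s => w s 0 j *: (E j s : 'rV[R]_n)) t : 'rV[R]_n).
  elim: r => [|j r IH].
    (* For the empty sum, additivity of [D] on 0 + 0 forces D 0 = 0. *)
    have Z := sums [::]; have := cdD cD Z Z It.
    have -> : (fun s => (\sum_(j <- [::]) w s 0 j *: (E j s : 'rV[R]_n)) +
        \sum_(j <- [::]) w s 0 j *: (E j s : 'rV[R]_n)) =
      (fun s => \sum_(j <- [::]) w s 0 j *: (E j s : 'rV[R]_n)).
      by apply: functional_extensionality_dep => s; rewrite !big_nil addr0.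
    by move/esym/eqP; rewrite -subr_eq0 addrK => /eqP ->; rewrite big_nil.
  rewrite [RHS]big_cons -IH -(cdD cD (wEs j) (sums r) It); congr (D _ t).
  by apply: functional_extensionality_dep => s; rewrite big_cons.
have wt : is_wder I w t (wderive I u t).
  have [H _] := us 1%N.
  apply: (is_wder_eq _ It (wderivableP (H t It))).
  by apply: filterE => s Is; rewrite wu.
have DE j : D (fun s => w s 0 j *: (E j s : 'rV[R]_n)) t =
    wderive I u t 0 j *: (E j t : 'rV[R]_n) +
    w t 0 j *: (phi (lconn nabla (left_velocity a b g t) (delta_mx 0 j)) (g t)
                : 'rV[R]_n).
  have wj : smooth_within `[a, b] (fun s => w s 0 j : R^o).
    by apply/smooth_withinP => k; exact: (Ck_rel_coord HI j (relopenT I) (ws k)).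
  rewrite (cd_leibniz cD wj (Es j) It).
  rewrite (is_wderE HI It (is_wder_coord (j := j) wt)).
  (* [cd_extendible] asks X to match the velocity only at the time t, so the left-invariant field
     through that one vector will do. *)
  have vE : fld (left_velocity a b g t) (g t) = velocity a b g t.
    by rewrite -left_velocityE.
  rewrite (cd_extendible cD (phi_smooth (left_velocity a b g t))
    (phi_smooth (delta_mx 0 j)) It vE).
  by rewrite (conn_phi ipR ipL LC).
rewrite WD Dsum (eq_bigr _ (fun j _ => DE j)) big_split /=.
rewrite [RHS]phiD; congr (_ + _); first by rewrite [RHS]phi_sum.
rewrite wu//.
rewrite [lconn _ _ (u t)](bilinear_expandr (lconnDr LC) (lconnZr LC)).
have fD : {morph ((@phi R n G)^~ (g t)) : x y / x + y >-> x + y}.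
  by move=> *; exact: phiD.
rewrite (big_morph _ fD (dL0 _ _)); apply: eq_bigr => j _.
by rewrite [RHS]phiZ.
Qed.

End Metric.
End LieCurves.

Lemma fdifferentiable_comp (R : realType) (n : nat) (M N : manifoldType R n)
    (f : N -> R) (F : M -> N) (p : M) :
  mdifferentiable F p -> fdifferentiable f (F p) -> fdifferentiable (f \o F) p.
Proof.
move=> Fp fp c ac cp.
have ad := chart_at_atlas (F p); have dp := chart_at_dom (F p).
have H := is_diff_chart_comp cp dp Fp.1 (differentiableP (fp _ ad dp))
  (is_diff_chart Fp ac ad cp dp).
exact: (@ex_diff _ _ _ _ _ _ _ H).
Qed.

(** Here [c] is nabla_xi eta', which arises once from differentiating nabla_xi eta and once from the
    last nabla_xi; hence the factor 2. *)
Lemma third_derivative_sum (R : realType) (n : nat) (x y z c d : 'rV[R]_n) :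
  x + (y + z + c) + (c + d) = x + 2 *: c + y + z + d.
Proof. by apply/rowP => j; rewrite !mxE; ring. Qed.

(** * The equation in the Lie algebra *)

Section ThirdDerivative.
Context {R : realType} {n : nat} {G : lieGroupType R n}.
Variables (a b : R).
Hypothesis ab : a < b.
Local Notation I := (`[a, b]%classic : set R).
Local Notation HI := (fun t => @limit_point_itvcc R a b t ab).
Variables (ip : metric G) (nabla : vfield G -> vfield G -> vfield G).
Hypotheses (ipR : riemannian ip) (ipL : left_invariant ip)
  (LC : levi_civita ip nabla).
Local Notation cN := (lconn nabla).
Variables (g : R -> G) (D : (forall t, tangent (g t)) -> forall t, tangent (g t)).
Hypotheses (gs : curve_smooth a b g) (cD : covariant_derivative nabla a b D).
Variable eta : R -> 'rV[R]_n.
Hypothesis etas : forall k, Ck_rel I I k eta.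
Let xi : R -> 'rV[R]_n := left_velocity a b g.
Let ad t : 'rV[R]_n := ad_dagger ip (xi t) (xi t).
Hypothesis xiE : forall t, I t -> wderive I xi t = eta t + ad t.

Lemma acceleration_phi t : I t -> D (velocity a b g) t = phi (eta t) (g t).
Proof.
move=> It; rewrite (covariant_derivative_phi ab ipR ipL LC (u := xi) gs cD _ _ It).
- by rewrite xiE// /ad (ad_dagger_self ipR ipL LC) subrK.
- exact: (left_velocity_smooth ab ipR ipL gs).
- by move=> s _; exact: left_velocityE.
Qed.

Lemma third_derivative_phi t : I t ->
  D (D (D (velocity a b g))) t =
  phi (wderive I (wderive I eta) t + 2 *: cN (xi t) (wderive I eta t)
    + cN (eta t) (eta t) + cN (ad t) (eta t)
    + cN (xi t) (cN (xi t) (eta t)) : 'rV[R]_n) (g t).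
Proof.
move=> It; have xis := left_velocity_smooth ab ipR ipL gs : forall k, Ck_rel I I k xi.
have etas1 k : Ck_rel I I k (wderive I eta) by have [_] := etas k.+1.
pose w s := wderive I eta s + cN (xi s) (eta s).
have ws k : Ck_rel I I k w.
  apply: (Ck_relD HI (relopenT I) (etas1 k)).
  exact: (Ck_rel_bilinear HI (lconnDl LC) (lconnZl LC) (lconnDr LC) (lconnZr LC)
    (relopenT I) (xis k) (etas k)).
have D2 s : I s -> D (D (velocity a b g)) s = phi (w s) (g s).
  move=> Is.
  by rewrite (covariant_derivative_phi ab ipR ipL LC gs cD etas acceleration_phi Is).
rewrite (covariant_derivative_phi ab ipR ipL LC gs cD ws D2 It).
have [xi1 _] := xis 1%N; have [eta1 _] := etas 1%N; have [eta2 _] := etas1 1%N.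
have wt := is_wderD (wderivableP (eta2 t It))
  (is_wder_bilinear (lconnDl LC) (lconnZl LC) (lconnDr LC) (lconnZr LC)
    (wderivableP (xi1 t It)) (wderivableP (eta1 t It))).
rewrite (is_wderE HI It wt) xiE// -/xi /w (lconnDl LC) (lconnDr LC).
congr (phi _ (g t)); exact: third_derivative_sum.
Qed.

End ThirdDerivative.

Theorem proposition3p4 (R : realType) (n : nat) (G : lieGroupType R n)
  (G_connected : connected [set: G])
  (ip : metric G) (ip_riemannian : riemannian ip)
  (ip_left_invariant : left_invariant ip)
  (nabla : vfield G -> vfield G -> vfield G)
  (nabla_levi_civita : levi_civita ip nabla)
  (V : G -> R) (V_smooth : smooth_fun V) (V_ge0 : forall x, 0 <= V x)
  (g0 : G) (Vext : G * G -> R) (Vext_smooth : smooth_fun2 Vext)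
  (Vext_g0 : forall x : G, Vext (x, g0) = V x)
  (Vext_invariant : forall x y z : G,
    Vext ((z * x)%g, (z * y)%g) = Vext (x, y))
  (a b : R) (a_lt_b : a < b)
  (Dt : forall c : R -> G,
    (forall t, tangent (c t)) -> forall t, tangent (c t))
  (Dt_covariant : forall c : R -> G, curve_smooth a b c ->
    covariant_derivative nabla a b (Dt c))
  (qa : G) (va : tangent qa) (qb : G) (vb : tangent qb)
  (g : R -> G) (g_Omega : admissible_curve a b va vb g) :
  let dg := velocity a b g in
  let xi := left_velocity a b g in
  let h : R -> G := fun t => (g0^-1 * g t)%g in
  (curve_smooth a b g /\
   forall t, t \in `[a, b] ->
     Dt g (Dt g (Dt g dg)) t
       + curvature_at nabla (Dt g dg t) (dg t) (dg t)
       + grad ip V (g t) = 0)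
  <->
  (smooth_within `[a, b] xi /\ curve_smooth a b h /\
   exists eta : R -> tangent (1%g : G),
     smooth_within `[a, b] eta /\
     forall t, t \in `[a, b] ->
       [/\ wderive `[a, b] xi t = eta t + ad_dagger ip (xi t) (xi t),
           0 = wderive `[a, b] (wderive `[a, b] eta) t
               + (2 : R) *: conn_alg nabla (xi t) (wderive `[a, b] eta t)
               + conn_alg nabla (eta t) (eta t)
               + conn_alg nabla (ad_dagger ip (xi t) (xi t)) (eta t)
               + conn_alg nabla (xi t) (conn_alg nabla (xi t) (eta t))
               + curvature_at nabla (eta t) (xi t) (xi t)
               + mdiff (Lmul (h t)^-1%g)
                   (grad ip (fun x => Vext (x, 1%g)) (h t))
         & velocity a b h t = mdiff (Lmul (h t)) (xi t)]).
Proof.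
move=> dg xi h.
have ipR := ip_riemannian; have ipL := ip_left_invariant.
have LC := nabla_levi_civita.
pose f (x : G) := Vext (x, 1%g).
(* Invariance under translation by g0 moves the second argument from e to g0. *)
have fV : f = V \o Lmul g0.
  by apply/funext => x; rewrite /f /= -Vext_g0 -(Vext_invariant x 1%g g0) mulg1.
have Vf : V = f \o Lmul g0^-1%g.
  by apply/funext => x; rewrite fV /= /Lmul mulVKg.
have fd x : fdifferentiable f x.
  rewrite fV; apply: fdifferentiable_comp; first exact: Lmul_mdiff.
  by apply: (smooth_fun_on_fdifferentiable V_smooth).
have grad_left t : left_coord (g t) (grad ip V (g t)) =
    mdiff (Lmul (h t)^-1%g) (grad ip f (h t)).
  rewrite {1}Vf -(left_coord_dL g0^-1%g) (dL_grad ipR ipL); last exact: fd.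
  by [].
have vel t : curve_smooth a b g -> t \in `[a, b] ->
    velocity a b h t = mdiff (Lmul (h t)) (xi t).
  move=> gs It; rewrite (velocity_Lmul a_lt_b g0^-1%g (gs 1%N) It).
  by rewrite left_velocityE dL_phi.
(* The left-hand side of the equation on G is the left translate of the equation in the Lie algebra
   for any eta satisfying the first equation. Since phi is injective at each point by [phi0], both
   directions reduce to this identity. *)
have main eta t : curve_smooth a b g -> smooth_within `[a, b] eta ->
    (forall t, t \in `[a, b] ->
      wderive `[a, b] xi t = eta t + ad_dagger ip (xi t) (xi t)) ->
    t \in `[a, b] ->
    Dt g (Dt g (Dt g dg)) t + curvature_at nabla (Dt g dg t) (dg t) (dg t)
      + grad ip V (g t) = 
    phi (wderive `[a, b] (wderive `[a, b] eta) t
               + (2 : R) *: conn_alg nabla (xi t) (wderive `[a, b] eta t)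
               + conn_alg nabla (eta t) (eta t)
               + conn_alg nabla (ad_dagger ip (xi t) (xi t)) (eta t)
               + conn_alg nabla (xi t) (conn_alg nabla (xi t) (eta t))
               + curvature_at nabla (eta t) (xi t) (xi t)
               + mdiff (Lmul (h t)^-1%g) (grad ip f (h t))) (g t).
  move=> gs etas xiE It.
  have cD := Dt_covariant g gs.
  have {}etas := (smooth_withinP a_lt_b _).1 etas.
  rewrite (third_derivative_phi a_lt_b ipR ipL LC gs cD etas xiE It).
  rewrite (acceleration_phi a_lt_b ipR ipL LC gs cD xiE It).
  rewrite [RHS]phiD [X in _ = X + _]phiD; congr (_ + _ + _).
    rewrite -[LHS](phi_left_coord (g t)) (left_coord_curvature_at ipR ipL LC).
    by rewrite left_coord_phi.
  by rewrite -[LHS](phi_left_coord (g t)) grad_left.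
have phi0 t (u : 'rV[R]_n) : phi u (g t) = 0 <-> 0 = u.
  split=> [H|<-]; last exact: dL0.
  by rewrite -(left_coord_phi (g t) u) H; exact: esym (dL0 _ _).
split=> [[gs H]|[xis [hs [eta [etas H]]]]].
  have xis := left_velocity_smooth a_lt_b ipR ipL gs.
  split; first exact/(smooth_withinP a_lt_b).
  split; first exact: curve_smooth_Lmul.
  (* The first equation leaves no other choice. By [ad_dagger_self] this is xi' + nabla_xi xi, whose
     smoothness follows from bilinearity. *)
  pose eta t : 'rV[R]_n := wderive `[a, b] xi t - ad_dagger ip (xi t) (xi t).
  exists eta.
  have etas : smooth_within `[a, b] eta.
    apply/(smooth_withinP a_lt_b) => k.
    pose HI := fun t => @limit_point_itvcc R a b t a_lt_b.
    have [_ xi1] := xis k.+1.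
    have := Ck_relD HI (relopenT _) xi1
      (Ck_rel_bilinear HI (lconnDl LC) (lconnZl LC) (lconnDr LC) (lconnZr LC)
        (relopenT _) (xis k) (xis k)).
    apply: (Ck_rel_eq HI (relopenT _)) => t _.
    by rewrite /eta (ad_dagger_self ipR ipL LC) opprK.
  split=> // t It; split.
  - by rewrite /eta subrK.
  - apply/(phi0 t); rewrite -(main eta t gs etas _ It).
      exact: H.
    by move=> s _; rewrite /eta subrK.
  - exact: vel.
(* In this direction smoothness is given for h and passes to g = g0 h by translation. *)
have gs : curve_smooth a b g.
  have := curve_smooth_Lmul a_lt_b g0 hs; congr (curve_smooth a b _).
  by apply/funext => t; rewrite /h mulVKg.
split=> // t It; rewrite (main eta t gs etas _ It); last by move=> s /H[].
by apply/phi0; have [] := H t It.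
Qed.
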